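(* Let $F$ be a probability distribution on the non-negative integers with $F(\{0\})=0$ and finite second moment. Then there exists $d_0$ such that for every even $d\ge d_0$ the cluster model with truncation level $d$ is well defined (all claimed clusters are almost surely finite) and the total length $T^d$ of all edges at the origin satisfies $\mathbb{E}[T^d]<\infty$.
   Context: Let $D_i$, $i\in\mathbb{Z}$, be i.i.d. with law $F$; attach $D_i$ stubs, labelled $1,\dots,D_i$, to vertex $i$. For even $d\in\mathbb{N}$ let $D_i^d=\max\{D_i-d,0\}$; stubs with label $>d$ are bad, others good; a vertex is high if $D_i>d$ and low otherwise. A vertex $i$ is claimed if $\sum_{k=i-m}^{i+m}D_k^d\ge m$ for some integer $m\ge1$; a cluster is a maximal set of consecutive claimed vertices. Cluster model (all random choices independent, uniform): Step 1: bad stubs are connected within their cluster $C$. If $C$ has one high vertex $i$, choose a random set of $D_i^d$ low vertices of $C$, take one stub from each and join them to the bad stubs of $i$. If $C$ has high vertices $i_1<\dots<i_h$, $h\ge2$: (i) if $h$ is even join $i_1$–$i_2$, $i_3$–$i_4$, \dots, $i_{h-1}$–$i_h$ using one bad stub from each; if $h$ is odd, with probability $1/2$ join the pairs $(i_1,i_2),\dots,(i_{h-2},i_{h-1})$ and otherwise the pairs $(i_2,i_3),\dots,(i_{h-1},i_h)$; (ii) with $b_r$ the number of still unconnected bad stubs in $C$, choose a random set of $b_r$ low vertices of $C$, take one stub from each and pair these randomly with the remaining bad stubs. Step 2: list all high vertices of $\mathbb{Z}$ in increasing order $\dots<i_{j}<i_{j+1}<\dots$; the $d$ good stubs of $i_j$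 are joined to good stubs at $i_{j+2},\dots,i_{j+d/2+1}$ and $i_{j-2},\dots,i_{j-d/2-1}$ (one edge to each). Step 3: the remaining unconnected stubs (all at low vertices) are connected by the Coin Toss rule: with $D'_i$ the number of remaining stubs at $i$ and $\Gamma_j=\{i:D'_i\ge j\}$, for each level $j$ the level-$j$ stubs get alternating directions right/left along $\Gamma_j$ (the direction at the first vertex $\ge0$ of $\Gamma_j$ chosen by a fair coin), and a level-$j$ stub at $i$ pointing right (left) is joined to the level-$j$ stub at the $(2j-1)$-th vertex of $\Gamma_j$ to the right (left) of $i$. The length of an edge $\{i,k\}$ is $|i-k|$; $T^d$ is the total length of all edges at vertex $0$. *)

(* Defs.v *)
From HB Require Import structures.
From mathcomp Require Import all_boot all_order all_algebra.
From mathcomp Require Import all_classical all_reals all_analysis.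
Set Implicit Arguments. Unset Strict Implicit. Unset Printing Implicit Defensive.
Import Order.TTheory GRing.Theory Num.Theory.
Local Open Scope classical_set_scope.
Local Open Scope ring_scope.

(* Sources of randomness: every random ingredient of the model is a   *)
(* function of a family of i.i.d. Uniform[0,1] random variables.       *)
(*   SDeg i  : generates the degree D_i (quantile transform of F)      *)
(*   SLab i  : a continuous label of vertex i, used for the uniformly   *)
(*             random choice (and random pairing) of low vertices      *)
(*   SCl i   : fair coin of the cluster whose leftmost vertex is i      *)
(*             (used when the number h of high vertices is odd)        *)
(*   SLev j  : fair coin giving the direction at level j in Step 3     *)
Inductive Src := SDeg of int | SLab of int | SCl of int | SLev of nat.

Definition mutually_independent (R : realType) (dm : measure_display)
  (T : measurableType dm) (P : probability T R) (I : Type) (X : I -> T -> R) :=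
  forall (n : nat) (f : 'I_n -> I) (B : 'I_n -> set R),
    injective f -> (forall k, measurable (B k)) ->
    P [set w | forall k : 'I_n, B k (X (f k) w)] =
    (\prod_(k < n) P [set w | B k (X (f k) w)])%E.

Definition uniform01_rv (R : realType) (dm : measure_display)
  (T : measurableType dm) (P : probability T R) (Y : T -> R) :=
  measurable_fun [set: T] Y /\
  forall x : R, 0 <= x <= 1 -> P [set w | Y w <= x] = x%:E.

(* Quantile transform: D = least n with u <= F 0 + ... + F n          *)
(* (then D has law F when u is Uniform[0,1]).                         *)
Definition cdfF (R : realType) (F : nat -> R) (n : nat) : R :=
  \sum_(0 <= k < n.+1) F k.
Definition quantile (R : realType) (F : nat -> R) (u : R) : nat :=
  xget 0%N [set n | u <= cdfF F n /\ forall m, (m < n)%N -> cdfF F m < u].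

Record config (R : realType) := Config {
  cD : int -> nat;
  cL : int -> R;
  cB : int -> bool;
  cC : nat -> bool      (* level coins (true = right) *)
}.

Definition cfg_of (R : realType) (F : nat -> R) (T : Type) (U : Src -> T -> R)
  (w : T) : config R :=
  Config (fun i => quantile F (U (SDeg i) w)) (fun i => U (SLab i) w)
         (fun i => U (SCl i) w < 2^-1) (fun j => U (SLev j) w < 2^-1).

Section Model.
Variables (R : realType) (d : nat) (c : config R).
Let D := cD c.

Definition Dd (k : int) : nat := (D k - d)%N.
Definition high (k : int) : bool := (d < D k)%N.

Definition window_sum (i : int) (m : nat) : nat :=
  \sum_(t < (2 * m).+1) Dd (i - m%:Z + t%:Z).

Definition claimed (i : int) : Prop :=
  exists m : nat, (1 <= m)%N /\ (m <= window_sum i m)%N.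

Definition between (i k j : int) : Prop :=
  (Order.min i k <= j) /\ (j <= Order.max i k).

Definition cluster_of (i : int) : set int :=
  [set k | forall j, between i k j -> claimed j].

Definition clusters_finite : Prop :=
  forall i, claimed i -> finite_set (cluster_of i).

Definition cl_left (i : int) : int :=
  xget i [set a | cluster_of i a /\ ~ claimed (a - 1)].
Definition cl_right (i : int) : int :=
  xget i [set b | cluster_of i b /\ ~ claimed (b + 1)].

Definition iseg (a b : int) : seq int :=
  [seq a + t%:Z | t <- iota 0 (`|b - a|%N).+1].

Definition hsC (a b : int) := [seq k <- iseg a b | high k].
Definition lowsC (a b : int) := [seq k <- iseg a b | ~~ high k].

(* offset of the first paired high vertex: 0 if h even; if h odd, with
   the cluster coin either pairs (i1,i2),... or (i2,i3),... *)
Definition pair_shift (a b : int) : nat :=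
  if odd (size (hsC a b)) && ~~ cB c a then 1%N else 0%N.

Definition pair_edges (a b : int) : seq (int * int) :=
  let hs := hsC a b in let s := pair_shift a b in
  [seq (nth 0 hs (s + 2 * t), nth 0 hs (s + 2 * t).+1)
     | t <- iota 0 (size hs)./2].

Definition paired (a b : int) (x : int) : bool :=
  x \in [seq nth 0 (hsC a b) (pair_shift a b + t) | t <- iota 0 (2 * (size (hsC a b))./2)].

(* remaining bad stubs, listed by their vertex *)
Definition bad_rest (a b : int) : seq int :=
  flatten [seq nseq (Dd x - paired a b x)%N x | x <- hsC a b].

(* low vertices in uniformly random order (increasing label) *)
Definition lab_le (u v : int) : bool :=
  (cL c u < cL c v) || ((cL c u == cL c v) && (u <= v)).

(* the random set of b_r low vertices, in random order *)
Definition chosen (a b : int) : seq int :=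
  take (size (bad_rest a b)) (sort lab_le (lowsC a b)).

Definition step1_edges (a b : int) : seq (int * int) :=
  pair_edges a b ++ zip (bad_rest a b) (chosen a b).

Definition len_at (i : int) (E : seq (int * int)) : nat :=
  sumn [seq `|e.1 - e.2|%N | e <- E & (e.1 == i) || (e.2 == i)].

Definition step1_len (i : int) : nat :=
  if `[< claimed i >] then len_at i (step1_edges (cl_left i) (cl_right i))
  else 0%N.

(* k-th vertex (k >= 1) strictly to the right / left of i satisfying p *)
Definition kth_right (p : int -> bool) (i : int) (k : nat) : int :=
  xget i [set v | i < v /\ p v /\
    count p [seq i + t%:Z | t <- iota 1 (`|v - i|%N).-1] = k.-1].
Definition kth_left (p : int -> bool) (i : int) (k : nat) : int :=
  xget i [set v | v < i /\ p v /\
    count p [seq v + t%:Z | t <- iota 1 (`|i - v|%N).-1] = k.-1].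

Definition step2_len (i : int) : nat :=
  if high i then
    \sum_(2 <= k < (d./2).+2)
       (`|kth_right high i k - i|%N + `|i - kth_left high i k|%N)
  else 0%N.

Definition chosen1 (v : int) : bool :=
  `[< claimed v >] && (v \in chosen (cl_left v) (cl_right v)).

(* D'_v : number of still unconnected stubs at v *)
Definition Dp (v : int) : nat := if high v then 0%N else (D v - chosen1 v)%N.

Definition Gam (j : nat) (v : int) : bool := (j <= Dp v)%N.

Definition first_nonneg (j : nat) : int :=
  xget 0 [set v | 0 <= v /\ Gam j v /\ forall u, 0 <= u < v -> ~~ Gam j u].

(* direction (true = right) of the level-j stub at i (i in Gam j):
   alternating along Gam j, coin at the first vertex >= 0 *)
Definition dir_right (j : nat) (i : int) : bool :=
  let f := first_nonneg j in
  let n := if f <= i then count (Gam j) (take `|i - f|%N (iseg f i))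
           else count (Gam j) (take `|f - i|%N (iseg i f)) in
  cC c j (+) odd n.

Definition len3 (j : nat) (i : int) : nat :=
  if dir_right j i then `|kth_right (Gam j) i (2 * j).-1 - i|%N
  else `|i - kth_left (Gam j) i (2 * j).-1|%N.

Definition step3_len (i : int) : nat :=
  \sum_(1 <= j < (Dp i).+1) len3 j i.

Definition total_len (i : int) : nat := (step1_len i + step2_len i + step3_len i)%N.

End Model.

(* Main.v *)
Require Import Defs.
From HB Require Import structures.
From mathcomp Require Import all_boot all_order all_algebra.
From mathcomp Require Import all_classical all_reals all_analysis.
From mathcomp Require Import measurable_realfun zify ring lra.
Import Order.TTheory GRing.Theory Num.Theory.
Local Open Scope classical_set_scope.
Local Open Scope ring_scope.

(** Write [a_k] for the excess [(D_k - d)^+]. Every claimed vertex has a one-sided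
    window on which [2 a] dominates the length, so a greedy covering shows: if half of
    [1..n] is claimed, then [n] is at most [32 a_0] plus the suprema of the two random
    walks with steps [32 a_k - 1] started to the right and to the left of [0]. For [d]
    large these walks have negative drift, and since [a] has a second moment their
    suprema have finite mean (Kiefer-Wolfowitz). As [a_0] is independent of the suprema,
    the cluster of [0] weighted by [a_0] has finite mean, which bounds the edges of
    Step 1; it also makes [sum_n P(half of 1..n is claimed)] finite, so clusters are
    finite almost surely. The waiting times of Step 2 have geometric tails. In Step 3,
    unclaimed vertices keep all their stubs, and given [a] the degrees at unclaimed
    vertices are still i.i.d.; hence when half of [1..n] is unclaimed, the probability
    of seeing only few vertices of level [j] decays geometrically in [n]. *)

(** * Covering of claimed vertices *)

(* [lia] does not identify big sums that are only convertible, so simplify and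
   generalize them first. *)
Ltac blia :=
  repeat match goal with H : is_true (leq _ _) |- _ => revert H end; simpl;
  repeat match goal with |- context [@bigop.body ?R ?I ?idx ?r ?f] =>
    generalize (@bigop.body R I idx r f) end;
  intros; lia.

(** The constants chain as follows. If a window of radius m carries mass at least m, one of its
    halves carries at least m/2, whence the factor 2 in [right_claimed]. A witnessing interval has m
    + 1 <= 2m points, whence the 4 of the covering. One of the two directions accounts for a quarter
    of 1..n, whence 16; doubling to 32 leaves the walk a height of at least n after paying one unit
    per step. The second moment enters twice: it makes the mean suprema finite, and it controls the
    square of a_0 when the cluster is weighted by a_0. The obstacle in Step 3 is that a claim
    depends on degrees at all distances, so the counts of level-j vertices are not sums of
    independent terms. Two devices remove it. Claims are decided in windows of bounded radius, with
    bounds uniform in the radius. And since claims are functions of the excesses, every unclaimed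
    vertex may be weighted by a function of its degree that has mean 1 given degree at most d. No
    conditional probability is ever formed: finite-dimensional expectations are iterated series, and
    limits are taken by monotone convergence. *)

Definition right_claimed (b : nat -> nat) (k : nat) : bool :=
  `[< exists m, (0 < m)%N /\ (m <= 2 * \sum_(t < m.+1) b (k + t)%N)%N >].

(* Greedy from left to right: jump over the witnessing interval of each
   right-claimed vertex; [y] is the overshoot of the last one. *)
Lemma right_claimed_covering (b : nat -> nat) (n p : nat) :
  exists y, (\sum_(k < n) right_claimed b (p + k) + y
             <= 4 * \sum_(k < n + y) b (p + k))%N.
Proof.
elim/ltn_ind: n p => -[|n] IH p; first by exists 0%N; rewrite big_ord0.
have [/asboolP[m [m0 hm]]|hp] := boolP (right_claimed b p); last first.
  have [y hy] := IH n (leqnn _) p.+1; exists y.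
  rewrite big_ord_recl addn0 (negbTE hp) add0n addSn big_ord_recl /= addn0.
  under eq_bigr do rewrite /= /bump /= add1n addnS -addSn.
  under [X in (_ <= 4 * (_ + X))%N]eq_bigr do rewrite /= /bump /= add1n addnS -addSn.
  by move: hy; blia.
have [mn|nm] := leqP m n.
  have [y hy] := IH (n - m)%N ltac:(lia) (p + m.+1)%N; exists y.
  have -> : n.+1 = (m.+1 + (n - m))%N by lia.
  rewrite -addnA big_split_ord [X in (_ <= 4 * X)%N]big_split_ord /=.
  under [X in (_ + X + _ <= _)%N]eq_bigr do rewrite addnA.
  under [X in (_ <= 4 * (_ + X))%N]eq_bigr do rewrite addnA.
  (* The witness interval has m + 1 vertices, and m + 1 <= 2m is at most 4 times its mass because m
     is positive. *)
  have : (\sum_(i < m.+1) right_claimed b (p + i) <= m.+1)%N.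
    rewrite -[X in (_ <= X)%N]card_ord -sum1_card.
    by apply: leq_sum => i _; case: right_claimed.
  blia.
(* The interval sticks out of the segment: counted vertices and overshoot together are at most m +
   1, again at most 4 times its mass. *)
exists (m - n)%N.
have -> : (n.+1 + (m - n) = m.+1)%N by lia.
have : (\sum_(i < n.+1) right_claimed b (p + i) <= n.+1)%N.
  rewrite -[X in (_ <= X)%N]card_ord -sum1_card.
  by apply: leq_sum => i _; case: right_claimed.
blia.
Qed.

(* Largest excursion of the walk with steps [32 x - 1], with truncated predecessor.
   A covering [J] has [|J| <= 16 a(J)], hence [32 a(J) - |J| >= |J|]. *)
Fixpoint lindley (l : seq nat) : nat :=
  if l is x :: l' then (32 * x + lindley l').-1 else 0%N.

Lemma lindley_take y l : (y <= size l)%N ->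
  (32 * sumn (take y l) <= lindley l + y)%N.
Proof. by elim: l y => [|x l IH] [|y] //=; rewrite ltnS => /IH; lia. Qed.

Lemma lindley_cat l l' : (lindley l <= lindley (l ++ l'))%N.
Proof. by elim: l => //= x l; lia. Qed.

Lemma lindley_mkseq (b : nat -> nat) N N' : (N <= N')%N ->
  (lindley (mkseq b N) <= lindley (mkseq b N'))%N.
Proof.
move=> NN; rewrite -(subnKC NN) /mkseq iotaD map_cat; exact: lindley_cat.
Qed.

Lemma sum_lindley (b : nat -> nat) y N : (y <= N)%N ->
  (32 * \sum_(k < y) b k <= lindley (mkseq b N) + y)%N.
Proof.
move=> yN; have := @lindley_take y (mkseq b N); rewrite size_mkseq => /(_ yN).
suff -> : (\sum_(k < y) b k)%N = sumn (take y (mkseq b N)) by [].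
rewrite /mkseq -map_take take_iota (minn_idPl yN) sumnE big_map.
by rewrite -(big_mkord xpredT b) /index_iota subn0.
Qed.

(** Window sums and claims for an arbitrary profile [a], so that they can be reflected and
    truncated; at [Dd d c] they are convertible to those of the model. *)
Definition wsum (a : int -> nat) (i : int) (m : nat) : nat :=
  \sum_(t < (2 * m).+1) a (i - m%:Z + t%:Z)%R.

Definition claimedb (a : int -> nat) (i : int) : bool :=
  `[< exists m : nat, (1 <= m)%N /\ (m <= wsum a i m)%N >].

Lemma wsum_split a i m :
  (wsum a i m <= \sum_(t < m.+1) a (i - t%:Z)%R + \sum_(t < m.+1) a (i + t%:Z)%R)%N.
Proof.
rewrite /wsum.
have -> : ((2 * m).+1 = m.+1 + m)%N by lia.
rewrite big_split_ord /= leq_add //.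
  rewrite (reindex_inj rev_ord_inj) /= leq_sum // => t _.
  by apply: eq_leq; congr a; have := ltn_ord t; lia.
rewrite [X in (_ <= X)%N]big_ord_recl /= (leq_trans _ (leq_addl _ _))//.
apply: leq_sum => t _; apply: eq_leq; congr a; rewrite /= /bump; lia.
Qed.

(** Both halves of a window contain its centre, and one of them carries half of the mass. The
    profiles [b] and [b'] read [a] to the right and to the left of [n], so that one covering lemma
    serves both directions. *)
Lemma claimedb_split a (n : int) (b b' : nat -> nat) (k k' : nat) :
  (forall t, b (k + t)%N = a (n + t%:Z)) ->
  (forall t, b' (k' + t)%N = a (n - t%:Z)) ->
  (claimedb a n <= right_claimed b k + right_claimed b' k')%N.
Proof.
move=> hb hb'; case: (boolP (claimedb a n)) => // /asboolP[p [p0 hp]].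
have := wsum_split a n p => hs.
have [h|h] := leqP p (2 * \sum_(t < p.+1) a (n + t%:Z)%R)%N.
  suff -> : right_claimed b k by [].
  by apply/asboolP; exists p; split => //; under eq_bigr do rewrite hb.
suff -> : right_claimed b' k' by rewrite addn1.
apply/asboolP; exists p; split => //; under eq_bigr do rewrite hb'.
blia.
Qed.

Definition nclaimed (a : int -> nat) (n : nat) : nat :=
  \sum_(k < n) claimedb a (1 + k%:Z)%R.

(** Vertex 0 is split off so that both excursions are independent of [a 0], by which [reach] will be
    multiplied. Truncation at [N] keeps everything finite. *)
Definition reach (a : int -> nat) (N : nat) : nat :=
  (lindley (mkseq (fun k => a (1 + k%:Z)%R) N) + 32 * a 0%R
   + lindley (mkseq (fun k => a (-1 - k%:Z)%R) N))%N.

Lemma reach_mono a N N' : (N <= N')%N -> (reach a N <= reach a N')%N.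
Proof.
by move=> NN; rewrite /reach !leq_add// lindley_mkseq.
Qed.

Lemma half_claimed_reach (a : int -> nat) (n : nat) :
  (n <= 2 * nclaimed a n)%N -> exists N, (n <= reach a N)%N.
Proof.
move=> hn.
pose b k := a (1 + k%:Z); pose b' k := a (n%:Z - k%:Z).
have [y hy] := right_claimed_covering b n 0.
have [x hx] := right_claimed_covering b' n 0.
have hle : (nclaimed a n <= \sum_(k < n) right_claimed b (0 + k)
                           + \sum_(k < n) right_claimed b' (0 + k))%N.
  rewrite [X in (_ <= _ + X)%N](reindex_inj rev_ord_inj) -big_split /=.
  apply: leq_sum => k _; apply: claimedb_split => // t; rewrite /b /b'; congr a;
  have := ltn_ord k; lia.
have sb u : (\sum_(k < u) b (0 + k) = \sum_(k < u) b k)%N by [].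
rewrite sb in hy; rewrite /reach.
(* Pigeonhole: one direction accounts for a quarter of 1..n. A covering to the right stays on
   positive vertices, so the right excursion alone suffices. *)
have [h|h] := leqP n (4 * \sum_(k < n) right_claimed b (0 + k))%N.
  exists (n + y)%N.
  have := @sum_lindley b (n + y) _ (leqnn _); rewrite -/b; blia.
have {}h : (n <= 4 * \sum_(k < n) right_claimed b' (0 + k))%N by blia.
exists (n + x)%N.
have h1 := @sum_lindley b n (n + x) (leq_addr _ _).
set b2 := (X in lindley (mkseq X _)) in h1 *.
set b3 := fun k => a (-1 - k%:Z).
(* The covering from n to the left has n + x vertices: 1..n, then 0, then only x - 1 negative
   ones. *)
have h3 := @sum_lindley b3 x.-1 (n + x) ltac:(lia).
have : (\sum_(k < n + x) b' (0 + k) <= \sum_(k < n) b k + a 0%R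
          + \sum_(k < x.-1) b3 k)%N.
  rewrite big_split_ord /= -addnA leq_add //.
    rewrite (reindex_inj rev_ord_inj) /= leq_sum // => t _.
    by apply: eq_leq; rewrite /b /b'; congr a; have := ltn_ord t; lia.
  case: (x) => [|x']; first by rewrite big_ord0.
  rewrite big_ord_recl /= leq_add//.
    by apply: eq_leq; rewrite /b'; congr a; lia.
  apply: leq_sum => t _; apply: eq_leq; rewrite /b' /b3; congr a.
  rewrite /= /bump; lia.
blia.
Qed.

(** * Iterated expectations *)

Section IteratedExpectation.
Context {R : realType}.
Variable F : nat -> R.
Hypothesis F_ge0 : forall n, 0 <= F n.
Hypothesis F_sum1 : (\sum_(0 <= n <oo) (F n)%:E = 1)%E.

Definition mean (f : nat -> R) : \bar R := (\sum_(0 <= k <oo) (F k * f k)%:E)%E.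

Implicit Types (f g : nat -> R) (h : seq nat -> R).

Lemma mean_ge0 f : (forall k, 0 <= f k) -> (0 <= mean f)%E.
Proof. by move=> f0; apply: nneseries_ge0 => k _ _; rewrite lee_fin mulr_ge0. Qed.

Lemma mean_cst c : 0 <= c -> mean (fun=> c) = c%:E.
Proof.
move=> c0; rewrite /mean; under eq_eseriesr do rewrite mulrC EFinM.
by rewrite nneseriesZl ?F_sum1 ?mule1// => k _; rewrite lee_fin.
Qed.

Lemma meanZ c f : 0 <= c -> (forall k, 0 <= f k) ->
  mean (fun k => c * f k) = (c%:E * mean f)%E.
Proof.
move=> c0 f0; rewrite /mean; under eq_eseriesr do rewrite mulrCA EFinM.
by rewrite nneseriesZl// => k _; rewrite lee_fin mulr_ge0.
Qed.

Lemma meanD f g : (forall k, 0 <= f k) -> (forall k, 0 <= g k) ->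
  mean (fun k => f k + g k) = (mean f + mean g)%E.
Proof.
move=> f0 g0; rewrite /mean; under eq_eseriesr do rewrite mulrDr EFinD.
by rewrite nneseriesD// => k _ _; rewrite lee_fin mulr_ge0.
Qed.

Lemma le_mean f g : (forall k, 0 <= f k) -> (forall k, f k <= g k) ->
  (mean f <= mean g)%E.
Proof.
move=> f0 fg; apply: lee_nneseries => k _; first by rewrite lee_fin mulr_ge0.
by rewrite lee_fin ler_wpM2l.
Qed.

(* The law of [(D_1, ..., D_n)], summed out one coordinate at a time. *)
Fixpoint iexp (n : nat) (h : seq nat -> R) : \bar R :=
  if n is n'.+1 then
    (\sum_(0 <= k <oo) (F k)%:E * iexp n' (fun l => h (k :: l)))%E
  else (h [::])%:E.

Lemma eq_iexp n h h' : (forall l, size l = n -> h l = h' l) -> iexp n h = iexp n h'.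
Proof.
elim: n h h' => [|n IH] h h' hh /=; first by rewrite hh.
by apply: eq_eseriesr => k _; congr (_ * _)%E; apply: IH => l sl; rewrite hh //= sl.
Qed.

Lemma iexp_ge0 n h : (forall l, 0 <= h l) -> (0 <= iexp n h)%E.
Proof.
elim: n h => [|n IH] h h0 /=; first by rewrite lee_fin.
by apply: nneseries_ge0 => k _ _; rewrite mule_ge0 ?lee_fin// IH.
Qed.

Lemma le_iexp n h h' : (forall l, 0 <= h l) ->
  (forall l, size l = n -> h l <= h' l) -> (iexp n h <= iexp n h')%E.
Proof.
elim: n h h' => [|n IH] h h' h0 hh /=; first by rewrite lee_fin hh.
apply: lee_nneseries => k _.
  by rewrite mule_ge0 ?lee_fin// iexp_ge0.
by rewrite lee_wpmul2l ?lee_fin// IH// => l sl; rewrite hh //= sl.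
Qed.

Lemma iexpD n h h' : (forall l, 0 <= h l) -> (forall l, 0 <= h' l) ->
  iexp n (fun l => h l + h' l) = (iexp n h + iexp n h')%E.
Proof.
elim: n h h' => [|n IH] h h' h0 h'0 //=.
rewrite -nneseriesD => [|k _ _|k _ _]; try by rewrite mule_ge0 ?lee_fin ?iexp_ge0.
by apply: eq_eseriesr => k _; rewrite IH// ge0_muleDr// iexp_ge0.
Qed.

Lemma iexpZ n c h : 0 <= c -> (forall l, 0 <= h l) ->
  iexp n (fun l => c * h l) = (c%:E * iexp n h)%E.
Proof.
elim: n h => [|n IH] h c0 h0 //=.
rewrite -nneseriesZl => [|k _]; last by rewrite mule_ge0 ?lee_fin ?iexp_ge0.
by apply: eq_eseriesr => k _; rewrite IH// muleCA.
Qed.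

Lemma iexp_cst n c : 0 <= c -> iexp n (fun=> c) = c%:E.
Proof.
elim: n => [|n IH] c0 //=; under eq_eseriesr do rewrite IH//.
by rewrite -[RHS]mean_cst.
Qed.

(** Independence of the first coordinate from the rest, as a product bound; it serves to multiply
    a_0 with an excursion that avoids 0. *)
Lemma iexp_cons_le n f (g : seq nat -> R) (A B : R) : (forall k, 0 <= f k) -> (forall l, 0 <= g l) ->
  0 <= B -> (mean f <= A%:E)%E -> (iexp n g <= B%:E)%E ->
  (iexp n.+1 (fun l => f (head 0%N l) * g (behead l))%R <= (A * B)%:E)%E.
Proof.
move=> f0 g0 B0 hA hB /=.
apply: (@le_trans _ _ (mean (fun k => B * f k))).
  apply: lee_nneseries => k _.
    by rewrite mule_ge0 ?lee_fin// iexp_ge0// => l; rewrite mulr_ge0.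
  rewrite iexpZ// EFinM lee_wpmul2l ?lee_fin// EFinM muleC.
  by rewrite lee_wpmul2r ?lee_fin.
by rewrite meanZ// EFinM muleC lee_wpmul2r ?lee_fin.
Qed.

(** Summing out an extra last coordinate costs nothing because [F] has mass 1. It yields
    monotonicity in [n] of moments of the excursion. *)
Lemma iexp_rcons_le n h h' : (forall l, 0 <= h l) ->
  (forall l x, h l <= h' (rcons l x)) -> (iexp n h <= iexp n.+1 h')%E.
Proof.
elim: n h h' => [|n IH] h h' h0 hh.
  rewrite /= -(mean_cst (h [::]))//.
  apply: lee_nneseries => k _; first by rewrite lee_fin mulr_ge0.
  by rewrite EFinM lee_wpmul2l ?lee_fin// (hh [::] k).
rewrite [X in (X <= _)%E]/=; apply: lee_nneseries => k _.
  by rewrite mule_ge0 ?lee_fin ?iexp_ge0.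
apply: lee_wpmul2l; rewrite ?lee_fin//.
by apply: (IH (fun l => h (k :: l)) (fun l => h' (k :: l))) => // l x; rewrite -rcons_cons hh.
Qed.

Lemma iexp_prod (g : nat -> R) rho n : (forall k, 0 <= g k) -> 0 <= rho ->
  mean g = rho%:E -> iexp n (fun l => \prod_(x <- l) g x) = (rho ^+ n)%:E.
Proof.
move=> g0 r0 hg; elim: n => [|n IH]; first by rewrite /= big_nil expr0.
rewrite exprS EFinM -hg muleC -meanZ ?exprn_ge0//=.
apply: eq_eseriesr => k _.
rewrite (@eq_iexp _ _ (fun l => g k * \prod_(x <- l) g x)); last first.
  by move=> l _; rewrite big_cons.
rewrite iexpZ => [|//|l]; last by rewrite prodr_ge0.
by rewrite IH EFinM [(rho ^+ n * _)]mulrC EFinM.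
Qed.

Section Excess.
Variable d : nat.

Definition jump (l : seq nat) : seq nat := [seq (x - d)%N | x <- l].

Variable m2 : R.
Hypothesis mean_sq : (mean (fun k => (32 * (k - d))%:R ^+ 2)%R <= m2%:E)%E.
Hypothesis mean_small : (mean (fun k => (32 * (k - d))%:R)%R <= (2^-1)%:E)%E.

Let W l : R := (lindley (jump l))%:R.

Let W0 l : 0 <= W l. Proof. by []. Qed.

(** The square of the truncated predecessor is at most (y + w - 1)^2, even for y = w = 0; expand and
    drop -2y. The term 2w on the left is the gain from the drift. *)
Lemma lindley_sq (y w : nat) :
  ((y + w).-1%:R : R) ^+ 2 + 2 * w%:R <= (y%:R ^+ 2 + 1) + 2 * y%:R * w%:R + w%:R ^+ 2.
Proof.
case: y => [|y].
  case: w => [|w]; first by rewrite /= !mulr0 expr0n /= !addr0 add0r ler01.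
  rewrite add0n /= -natr1; nra.
rewrite addSn /= natrD -natr1.
have := ler0n R y; have := ler0n R w; nra.
Qed.

(* Kiefer-Wolfowitz: comparing second moments in the recursion
   [W' = (Y + W - 1)^+] bounds the first moment of [W]. *)
Lemma lindley_step n (e v : R) : 0 <= e -> 0 <= v ->
  iexp n W = e%:E -> iexp n (fun l => W l ^+ 2) = v%:E ->
  (iexp n.+1 (fun l => W l ^+ 2)%R + e%:E <= (m2 + 1 + v)%:E)%E.
Proof.
move=> e0 v0 he hv.
(* The cross term is 2 E[Y] e, at most e since E[Y] <= 1/2. It consumes half of the gain 2e and
   leaves one e. *)
suff : (iexp n.+1 (fun l => W l ^+ 2)%R + (2 * e)%:E <= (m2 + 1 + e + v)%:E)%E.
  case: (iexp n.+1 _) => [r| |]; [by rewrite -!EFinD !lee_fin; lra|by []|by move=> _; rewrite addNye leNye].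
pose y k : R := (32 * (k - d))%:R.
have y0 k : 0 <= y k by [].
have hm : (mean (fun k => y k ^+ 2 + ((2 * e) * y k + (1 + v)))%R <= (m2 + 1 + e + v)%:E)%E.
  rewrite meanD; last 2 first.
  - by move=> k; rewrite sqr_ge0.
  - by move=> k; rewrite !addr_ge0// !mulr_ge0.
  rewrite meanD; last 2 first.
  - by move=> k; rewrite !mulr_ge0.
  - by move=> k; rewrite addr_ge0.
  rewrite meanZ ?mulr_ge0// mean_cst ?addr_ge0//.
  have -> : m2 + 1 + e + v = m2 + (2 * e * 2^-1 + (1 + v)) by field.
  rewrite (EFinD m2) leeD// (EFinD (2 * e * 2^-1)) leeD2r//.
  by rewrite (EFinM (2 * e)) lee_wpmul2l// lee_fin mulr_ge0.
apply: le_trans hm.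
have e20 : 0 <= 2 * e by rewrite mulr_ge0.
rewrite -(mean_cst (2 * e))//= -nneseriesD => [|k _ _|k _ _]; last 2 first.
- by rewrite mule_ge0 ?lee_fin// iexp_ge0// => l; rewrite sqr_ge0.
- by rewrite lee_fin mulr_ge0.
apply: lee_nneseries => k _.
  rewrite adde_ge0// ?lee_fin; last by rewrite mulr_ge0.
  by rewrite mule_ge0 ?lee_fin// iexp_ge0// => l; rewrite sqr_ge0.
rewrite !EFinM -EFinM -ge0_muleDr ?lee_fin//; last first.
  by rewrite iexp_ge0// => l; rewrite sqr_ge0.
rewrite lee_wpmul2l ?lee_fin//.
have -> : (2 * e)%:E = iexp n (fun l => 2 * W l) by rewrite iexpZ// he.
rewrite -iexpD; last 2 first.
- by move=> l; rewrite sqr_ge0.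
- by move=> l; rewrite mulr_ge0.
apply: (@le_trans _ _ (iexp n (fun l => (y k ^+ 2 + 1) + ((2 * y k) * W l + W l ^+ 2)))).
  apply: le_iexp => l; first by rewrite addr_ge0 ?sqr_ge0// mulr_ge0.
  by move=> _; rewrite addrA; exact: lindley_sq.
rewrite iexpD; last 2 first.
- by move=> l; rewrite addr_ge0// sqr_ge0.
- by move=> l; rewrite addr_ge0 ?sqr_ge0// !mulr_ge0.
rewrite iexp_cst; last by rewrite addr_ge0// sqr_ge0.
rewrite iexpD; last 2 first.
- by move=> l; rewrite !mulr_ge0.
- by move=> l; rewrite sqr_ge0.
rewrite iexpZ ?mulr_ge0// he hv -EFinM -!EFinD lee_fin; nra.
Qed.

(** The second moments v at [n] and v' at [n.+1] are finite, and v <= v' since appending an entry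
    never lowers the excursion. They therefore cancel in [lindley_step], leaving a bound uniform in
    [n]. The recursion adds an entry in front, the comparison one at the end; by exchangeability
    both concern the same [iexp n.+1]. *)
Lemma iexp_lindley_le n : (iexp n W <= (m2 + 1)%:E)%E.
Proof.
have sq0 l : 0 <= W l ^+ 2 by rewrite sqr_ge0.
(* Finiteness passes from k to k + 1: W is integral, so E[W] <= E[W^2], and then [lindley_step]
   applies. *)
have fin k : exists2 v, 0 <= v & iexp k (fun l => W l ^+ 2) = v%:E.
  elim: k => [|k [v v0 hv]]; first by exists 0; rewrite //= /W /= expr0n.
  have : (iexp k W <= v%:E)%E.
    rewrite -hv; apply: le_iexp => // l _.
    by rewrite -natrX ler_nat; case: (lindley _) => // w; rewrite -mulnn leq_pmull.
  have := iexp_ge0 k W W0.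
  case he : (iexp k W) => [e| |] //; rewrite !lee_fin => e0 _.
  have := lindley_step _ _ _ e0 v0 he hv; have := iexp_ge0 k.+1 _ sq0.
  by case: (iexp k.+1 _) => [r| |] //; rewrite lee_fin => r0; exists r.
have [v v0 hv] := fin n; have [v' v'0 hv'] := fin n.+1.
have : (iexp n W <= v%:E)%E.
  rewrite -hv; apply: le_iexp => // l _.
  by rewrite -natrX ler_nat; case: (lindley _) => // w; rewrite -mulnn leq_pmull.
have := iexp_ge0 n W W0.
case he : (iexp n W) => [e| |] //; rewrite !lee_fin => e0 _.
have := lindley_step _ _ _ e0 v0 he hv; rewrite hv' -EFinD lee_fin => h.
suff : (v%:E <= v'%:E)%E by rewrite lee_fin; lra.
rewrite -hv -hv'; apply: iexp_rcons_le => // l x.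
rewrite ler_pXn2r ?nnegrE// ler_nat /jump map_rcons -cats1.
exact: lindley_cat.
Qed.

End Excess.
End IteratedExpectation.

(** * Reweighting degrees given the excesses *)

Section ConditionalWeight.
Context {R : realType}.
Variable F : nat -> R.
Hypothesis F_ge0 : forall n, 0 <= F n.
Variables (d : nat) (psi : nat -> R).
Hypothesis psi_ge0 : forall k, 0 <= psi k.
Hypothesis psi_sum : \sum_(0 <= k < d.+1) F k * psi k = \sum_(0 <= k < d.+1) F k.

(* Given the jumps, the entries with zero jump are still i.i.d., so weighting any
   set of them that is determined by the jumps costs nothing in expectation. *)
Lemma iexp_weight n (Phi : seq nat -> R) (S : seq nat -> nat -> bool) :
  (forall al, 0 <= Phi al) ->
  (forall al t, S al t -> (t < size al)%N -> nth 0%N al t = 0%N) ->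
  iexp F n (fun l => Phi (jump d l) *
     \prod_(t < n) (if S (jump d l) t then psi (nth 0%N l t) else 1)) =
  iexp F n (fun l => Phi (jump d l)).
Proof.
elim: n Phi S => [|n IH] Phi S Phi0 HS /=; first by rewrite big_ord0 mulr1.
transitivity (\sum_(0 <= k <oo) (F k)%:E * iexp F n (fun l =>
    Phi (jump d (k :: l)) * (if S (jump d (k :: l)) 0%N then psi k else 1))%R)%E.
  apply: eq_eseriesr => k _; congr (_ * _)%E.
  rewrite -(IH (fun al => Phi ((k - d)%N :: al) *
      (if S ((k - d)%N :: al) 0%N then psi k else 1))
    (fun al t => S ((k - d)%N :: al) t.+1)).
  - apply: eq_iexp => l _; rewrite big_ord_recl /= mulrA; congr (_ * _).
  - by move=> al; rewrite mulr_ge0//; case: ifP.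
  - by move=> al t /HS.
have nn k : (0 <= (F k)%:E * iexp F n (fun l =>
    Phi (jump d (k :: l)) * (if S (jump d (k :: l)) 0%N then psi k else 1))%R)%E.
  by rewrite mule_ge0 ?lee_fin// iexp_ge0// => l; rewrite mulr_ge0//; case: ifP.
have nn' k : (0 <= (F k)%:E * iexp F n (fun l => Phi (jump d (k :: l))))%E.
  by rewrite mule_ge0 ?lee_fin// iexp_ge0.
(* First entries above [d] have positive jump, so position 0 is not in [S] and no weight is present.
   Entries up to [d] all have jump 0 and are indistinguishable to [Phi] and [S]. *)
rewrite (nneseries_split 0 d.+1)// [RHS](nneseries_split 0 d.+1)// !add0n.
congr (_ + _)%E; last first.
  rewrite !(@eseries_cond _ _ _ d.+1).
  apply: eq_eseriesr => k dk; congr (_ * _)%E.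
  apply: eq_iexp => l _; case: ifP => [/HS|]; last by rewrite mulr1.
  by move=> /(_ isT) /= ; lia.
(* [A1] and [A2] are the parts where position 0 is, respectively is not, weighted; neither depends
   on k, so [psi_sum] averages the weight to 1. *)
pose A1 := iexp F n (fun l => Phi (0%N :: jump d l) * (S (0%N :: jump d l) 0%N)%:R).
pose A2 := iexp F n (fun l => Phi (0%N :: jump d l) * (~~ S (0%N :: jump d l) 0%N)%:R).
have A10 : (0 <= A1)%E by rewrite iexp_ge0// => l; rewrite mulr_ge0.
have A20 : (0 <= A2)%E by rewrite iexp_ge0// => l; rewrite mulr_ge0.
transitivity (\sum_(0 <= k < d.+1) (A1 * (F k * psi k)%:E + A2 * (F k)%:E))%E.
  rewrite !big_nat; apply: eq_bigr => k /andP[_ kd].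
  have kd0 : (k - d = 0)%N by lia.
  rewrite EFinM muleCA (muleC A2) -ge0_muleDr ?mule_ge0 ?lee_fin//.
  congr (_ * _)%E; rewrite muleC -iexpZ// -?iexpD//.
  - apply: eq_iexp => l _; rewrite /jump /= kd0.
    by case: (S _ _); rewrite /= ?mulr1 ?mulr0 ?addr0 ?add0r// mulrC.
  - by move=> l; rewrite !mulr_ge0.
  - by move=> l; rewrite mulr_ge0.
  - by move=> l; rewrite mulr_ge0.
rewrite big_split /= -!ge0_sume_distrr => [|k _|k _]; try by rewrite lee_fin ?mulr_ge0.
rewrite !sumEFin psi_sum -sumEFin !ge0_sume_distrr => [|k _|k _];
  try by rewrite lee_fin ?mulr_ge0.
rewrite -big_split /= !big_nat; apply: eq_bigr => k /andP[_ kd].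
have kd0 : (k - d = 0)%N by lia.
rewrite ![(_ * (F k)%:E)%E]muleC -ge0_muleDr//; congr (_ * _)%E.
rewrite -iexpD//; last 2 first.
- by move=> l; rewrite mulr_ge0.
- by move=> l; rewrite mulr_ge0.
apply: eq_iexp => l _; rewrite /jump /= kd0.
by case: (S _ _); rewrite /= ?mulr1 ?mulr0 ?addr0 ?add0r.
Qed.

End ConditionalWeight.

(** * Measurability of countably valued maps *)

Section DiscreteMeasurability.
Context {dm : measure_display} {T : measurableType dm}.

(** Apart from the uniform variables, the objects of the model take countably many values. Fibres
    over points then suffice, any function preserves the property, and no sigma-algebra on sequences
    or integers is needed. *)
Definition dmeas {X : Type} (f : T -> X) := forall x, measurable [set w | f w = x].

Lemma eq_dmeas {X : Type} (f g : T -> X) : (forall w, f w = g w) -> dmeas f -> dmeas g.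
Proof. by move=> fg hf x; under eq_set do rewrite -fg; exact: hf. Qed.

Lemma mset_Prop (p : Prop) : measurable [set w : T | p].
Proof.
have [hp|hp] := pselect p.
  by rewrite (_ : [set w | p] = setT)//; apply/seteqP; split.
by rewrite (_ : [set w | p] = set0)//; apply/seteqP; split.
Qed.

Lemma mset_not (Q : T -> Prop) :
  measurable [set w | Q w] -> measurable [set w | ~ Q w].
Proof. by move=> hQ; exact: measurableC. Qed.

Lemma mset_and (Q Q' : T -> Prop) : measurable [set w | Q w] ->
  measurable [set w | Q' w] -> measurable [set w | Q w /\ Q' w].
Proof. by move=> hQ hQ'; exact: measurableI. Qed.

Lemma mset_or (Q Q' : T -> Prop) : measurable [set w | Q w] ->
  measurable [set w | Q' w] -> measurable [set w | Q w \/ Q' w].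
Proof. by move=> hQ hQ'; exact: measurableU. Qed.

Lemma mset_ex (I : countType) (Q : I -> T -> Prop) :
  (forall i, measurable [set w | Q i w]) -> measurable [set w | exists i, Q i w].
Proof.
move=> hQ; rewrite (_ : [set _ | _] = \bigcup_i [set w | Q i w]).
  by apply: countable_bigcupT_measurable => //; exact: countableP.
by apply/seteqP; split => w [i]; [exists i|move=> _ ?; exists i].
Qed.

Lemma mset_all (I : countType) (Q : I -> T -> Prop) :
  (forall i, measurable [set w | Q i w]) -> measurable [set w | forall i, Q i w].
Proof.
move=> hQ; rewrite (_ : [set _ | _] = ~` [set w | exists i, ~ Q i w]).
  apply: measurableC; apply: mset_ex => i; exact: mset_not.
by apply/seteqP; split => w /=; [move=> h [i]; exact|move=> h i; apply: contra_notP h; exists i].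
Qed.

Lemma mset_imply (p : Prop) (Q : T -> Prop) :
  (p -> measurable [set w | Q w]) -> measurable [set w | p -> Q w].
Proof.
move=> hQ; have [hp|hp] := pselect p.
  rewrite (_ : [set _ | _] = [set w | Q w]); first exact: hQ.
  by apply/seteqP; split => w /= h //; exact: h.
by rewrite (_ : [set _ | _] = setT)//; apply/seteqP; split => w //= _ /hp.
Qed.

Lemma dmeas_cst {X : Type} (x : X) : dmeas (fun=> x).
Proof. by move=> y; exact: mset_Prop. Qed.

(** A countable union over the values of [f]; it allows random parameters such as cluster endpoints
    to be frozen. *)
Lemma dmeas_bind {X : countType} {Y : Type} (f : T -> X) (g : X -> T -> Y) :
  dmeas f -> (forall x, dmeas (g x)) -> dmeas (fun w => g (f w) w).
Proof.
move=> hf hg y.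
rewrite (_ : [set _ | _] = [set w | exists x, f w = x /\ g x w = y]).
  by apply: mset_ex => x; apply: mset_and; [exact: hf|exact: hg].
by apply/seteqP; split => w /=; [move=> <-; exists (f w)|move=> [x [<-]]].
Qed.

Lemma dmeas_comp {X : countType} {Y : Type} (h : X -> Y) (f : T -> X) :
  dmeas f -> dmeas (fun w => h (f w)).
Proof. by move=> hf; apply: (dmeas_bind f (fun x _ => h x)) => // x; exact: dmeas_cst. Qed.

Lemma dmeas_comp2 {X Y : countType} {Z : Type} (h : X -> Y -> Z) (f : T -> X) (g : T -> Y) :
  dmeas f -> dmeas g -> dmeas (fun w => h (f w) (g w)).
Proof.
move=> hf hg; apply: (dmeas_bind f (fun x w => h x (g w))) => // x.
exact: dmeas_comp.
Qed.

Lemma dmeas_asbool (Q : T -> Prop) : measurable [set w | Q w] -> dmeas (fun w => `[< Q w >]).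
Proof.
move=> hQ [].
  by rewrite (_ : [set _ | _] = [set w | Q w])//; apply/seteqP; split => w /= /asboolP.
rewrite (_ : [set _ | _] = [set w | ~ Q w]); first exact: mset_not.
by apply/seteqP; split => w /=; [move/negbT/asboolPn|move/asboolPn/negbTE].
Qed.

Lemma mset_bool (b : T -> bool) : dmeas b -> measurable [set w | b w].
Proof. by move=> hb; exact: hb. Qed.

Lemma mset_pred {X : countType} (f : T -> X) (q : X -> Prop) :
  dmeas f -> measurable [set w | q (f w)].
Proof.
move=> hf; rewrite (_ : [set _ | _] = [set w | exists x, q x /\ f w = x]).
  by apply: mset_ex => x; apply: mset_and; [exact: mset_Prop|exact: hf].
by apply/seteqP; split => w /=; [move=> ?; exists (f w)|move=> [x [? ->]]].
Qed.

Lemma dmeas_if {X : Type} (b : T -> bool) (f g : T -> X) :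
  dmeas b -> dmeas f -> dmeas g -> dmeas (fun w => if b w then f w else g w).
Proof.
by move=> hb hf hg; apply: (dmeas_bind b (fun b w => if b then f w else g w)) => // -[].
Qed.

Lemma dmeas_map {I : Type} {X : countType} (f : I -> T -> X) (s : seq I) :
  (forall i, dmeas (f i)) -> dmeas (fun w => [seq f i w | i <- s]).
Proof.
move=> hf; elim: s => [|i s IH] /=; first exact: dmeas_cst.
exact: (dmeas_comp2 cons).
Qed.

Lemma dmeas_filter {I : countType} (p : I -> T -> bool) (s : seq I) :
  (forall i, dmeas (p i)) -> dmeas (fun w => [seq i <- s | p i w]).
Proof.
move=> hp; have := dmeas_map p s hp => hm.
apply: eq_dmeas (dmeas_comp (fun m => mask m s) _ hm) => w.
by rewrite filter_mask.
Qed.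

Lemma dmeas_count {I : countType} (p : I -> T -> bool) (s : seq I) :
  (forall i, dmeas (p i)) -> dmeas (fun w => count (fun i => p i w) s).
Proof.
move=> hp; apply: eq_dmeas (dmeas_comp size _ (dmeas_filter p s hp)) => w.
by rewrite size_filter.
Qed.

Lemma dmeas_sum {I : Type} (f : I -> T -> nat) (s : seq I) :
  (forall i, dmeas (f i)) -> dmeas (fun w => (\sum_(i <- s) f i w)%N).
Proof.
move=> hf; apply: eq_dmeas (dmeas_comp sumn _ (dmeas_map f s hf)) => w.
by rewrite sumnE big_map.
Qed.

(** Uniqueness of the witness makes the unspecified choice of [xget] explicit: the value is x if x
    is the witness, or if x is the default and there is none. *)
Lemma dmeas_xget {X : countType} (x0 : X) (S : T -> set X) :
  (forall w x y, S w x -> S w y -> x = y) ->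
  (forall x, measurable [set w | S w x]) -> dmeas (fun w => xget x0 (S w)).
Proof.
move=> uS mS x.
rewrite (_ : [set _ | _] = [set w | S w x \/ (x0 = x /\ forall y, ~ S w y)]).
  apply: mset_or => //; apply: mset_and; first exact: mset_Prop.
  by apply: mset_all => y; exact: mset_not.
apply/seteqP; split => w /=.
  by case: xgetP => [y -> Sy <-|Sn <-]; [left|right].
case=> [Sx|[<- Sn]]; last by rewrite xgetPN.
by case: xgetP => [y -> Sy|/(_ x)//]; exact: uS Sy Sx.
Qed.

Lemma dmeas_measurable {R : realType} (f : T -> nat) : dmeas f ->
  measurable_fun setT (fun w => (f w)%:R : R).
Proof. by move=> hf _ B mB; rewrite setTI; exact: (mset_pred f (fun n => B n%:R)). Qed.

Lemma dmeas_measurable_EFin {R : realType} {X : countType} (f : T -> X) (h : X -> R) D :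
  dmeas f -> measurable_fun D (fun w => (h (f w))%:E : \bar R).
Proof.
move=> hf mD B mB; apply: measurableI => //.
exact: (mset_pred f (fun x => B (h x)%:E)).
Qed.

(** * Expectations of integer-valued maps *)

Section Integrals.
Context {R : realType}.
Variable P : probability T R.

Definition expect (f : T -> nat) : \bar R := (\int[P]_w ((f w)%:R)%:E)%E.

Lemma expectD f g : dmeas f -> dmeas g ->
  expect (fun w => f w + g w)%N = (expect f + expect g)%E.
Proof.
move=> hf hg; rewrite /expect -ge0_integralD//; last 2 first.
- exact: (dmeas_measurable_EFin f (fun n => n%:R)).
- exact: (dmeas_measurable_EFin g (fun n => n%:R)).
by apply: eq_integral => w _; rewrite natrD EFinD.
Qed.

Lemma expectZ f c : dmeas f -> expect (fun w => c * f w)%N = (c%:R%:E * expect f)%E.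
Proof.
move=> hf; rewrite /expect -ge0_integralZl//.
- by apply: eq_integral => w _; rewrite natrM EFinM.
- exact: (dmeas_measurable_EFin f (fun n => n%:R)).
Qed.

Lemma le_expect f g : dmeas f -> dmeas g -> (forall w, f w <= g w)%N ->
  (expect f <= expect g)%E.
Proof.
move=> hf hg fg; apply: ge0_le_integral => //.
- exact: (dmeas_measurable_EFin f (fun n => n%:R)).
- exact: (dmeas_measurable_EFin g (fun n => n%:R)).
- by move=> w _; rewrite lee_fin ler_nat.
Qed.

Lemma expect_sum (I : Type) (s : seq I) (f : I -> T -> nat) :
  (forall i, dmeas (f i)) ->
  expect (fun w => \sum_(i <- s) f i w)%N = (\sum_(i <- s) expect (f i))%E.
Proof.
move=> hf; elim: s => [|i s IH].
  rewrite big_nil /expect; under eq_integral do rewrite big_nil.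
  by rewrite integral0.
rewrite big_cons -IH -expectD//; last exact: dmeas_sum.
by congr expect; apply/funext => w; rewrite big_cons.
Qed.

Lemma expect_bool (b : T -> bool) : dmeas b ->
  expect (fun w => b w : nat) = P [set w | b w].
Proof.
move=> hb; rewrite -[RHS]mul1e -integral_cst//; last exact: hb.
rewrite integral_mkcond; apply: eq_integral => w _; rewrite patchE.
by case: ifPn; rewrite ?inE ?notin_setE /=; case: (b w).
Qed.

(** The minima of [g] and [f n] increase to [g], so monotone convergence applies. The supremum of
    [f], which may be infinite, is never formed. *)
Lemma expect_monotone_bound (g : T -> nat) (f : nat -> T -> nat) (C : \bar R) :
  dmeas g -> (forall n, dmeas (f n)) ->
  (forall w n m, (n <= m)%N -> (f n w <= f m w)%N) ->
  (forall w, exists n, (g w <= f n w)%N) ->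
  (forall n, expect (f n) <= C)%E -> (expect g <= C)%E.
Proof.
move=> hg hf fmono gf fC.
pose h n w : \bar R := ((minn (g w) (f n w))%:R)%:E.
have mh n : dmeas (fun w => minn (g w) (f n w)) by exact: (dmeas_comp2 minn).
have -> : expect g = (\int[P]_w limn (h^~ w))%E.
  apply: eq_integral => w _; apply/esym/cvg_lim => //.
  have [n0 hn0] := gf w; apply: (cvg_near_cst); exists n0 => // n /= n0n.
  by rewrite /h (minn_idPl _)// (leq_trans hn0)// fmono.
rewrite monotone_convergence//.
- apply: lime_le.
    apply: ereal_nondecreasing_is_cvgn => n m nm.
    apply: (le_expect _ _ (mh n) (mh m)) => w.
    by rewrite leq_min geq_minl /= (leq_trans (geq_minr _ _))// fmono.
  near=> n; apply: le_trans (fC n).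
  by apply: (le_expect _ _ (mh n) (hf n)) => w; rewrite geq_minr.
- by move=> n; exact: (dmeas_measurable_EFin _ (fun n => n%:R) _ (mh n)).
- by move=> n w _; rewrite lee_fin.
- move=> w _ n m nm; rewrite lee_fin ler_nat.
  by rewrite leq_min geq_minl /= (leq_trans (geq_minr _ _))// fmono.
Unshelve. all: by end_near. Qed.

Lemma sum_lt (f n : nat) : (\sum_(i < n) (i < f) = minn f n)%N.
Proof. by elim: n => [|n IH]; rewrite ?big_ord0 ?minn0// big_ord_recr /= IH; lia. Qed.

Lemma expect_tail_bound (f : T -> nat) (C : \bar R) : dmeas f ->
  (forall n, \sum_(i < n) P [set w | (i < f w)%N] <= C)%E -> (expect f <= C)%E.
Proof.
move=> hf hC.
have mi i : dmeas (fun w => (i < f w)%N) by exact: (dmeas_comp (fun n => (i < n)%N)).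
apply: (expect_monotone_bound f (fun n w => minn (f w) n)) => //.
- by move=> n; exact: (dmeas_comp (fun m => minn m n)).
- by move=> w n m nm; lia.
- by move=> w; exists (f w); rewrite minnn.
move=> n; apply: le_trans (hC n).
under eq_bigr do rewrite -expect_bool//.
rewrite -expect_sum; last by move=> i; exact: (dmeas_comp nat_of_bool).
rewrite le_eqVlt; apply/orP; left; apply/eqP.
by congr expect; apply/funext => w; rewrite sum_lt.
Qed.

End Integrals.
End DiscreteMeasurability.

(** * Independent families *)

Section IIDFamily.
Context {R : realType} {dm : measure_display} {T : measurableType dm}.
Variables (P : probability T R) (F : nat -> R).
Hypothesis F_ge0 : forall n, 0 <= F n.
Hypothesis F_sum1 : (\sum_(0 <= n <oo) (F n)%:E = 1)%E.

(** Stated by point probabilities over duplicate-free lists of vertices, which is the form that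
    turns expectations into [iexp]. *)
Definition iid (D : int -> T -> nat) :=
  (forall i, dmeas (D i)) /\
  forall s l, uniq s -> size l = size s ->
    P [set w | [seq D i w | i <- s] = l] = (\prod_(x <- l) F x)%:E.

(** Transfers every estimate on the right half-line to the left one. *)
Lemma iid_opp D : iid D -> iid (fun i => D (- i)).
Proof.
move=> [mD hD]; split=> // s l us sl.
rewrite -(hD (map -%R s) l); last 2 first.
- by rewrite map_inj_uniq//; exact: oppr_inj.
- by rewrite size_map.
by congr (P _); apply/seteqP; split => w /=; rewrite -map_comp.
Qed.

Section OneFamily.
Variable D : int -> T -> nat.
Hypothesis D_iid : iid D.

Let Ds s w := [seq D i w | i <- s].

Let mDs s : dmeas (Ds s).
Proof. by apply: dmeas_map; case: D_iid. Qed.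

Lemma integral_iid_in s s' l' (h : seq nat -> R) : (forall l, 0 <= h l) ->
  uniq (s ++ s') -> size l' = size s' ->
  (\int[P]_(w in [set w | Ds s' w = l']) (h (Ds s w))%:E =
   (\prod_(x <- l') F x)%:E * iexp F (size s) h)%E.
Proof.
move=> + + sl'; elim: s s' l' sl' h => [|i s IH] s' l' sl' h h0 us /=.
  rewrite -[RHS]muleC -(proj2 D_iid s')// -integral_cst//; exact: mDs.
pose A k := [set w | Ds (i :: s') w = k :: l'].
have -> : [set w | Ds s' w = l'] = \bigcup_k A k.
  apply/seteqP; split => w /=; first by move=> e; exists (D i w) => //; rewrite /A /Ds /= -e.
  by move=> [k _]; rewrite /A /= => -[].
rewrite ge0_integral_bigcup//.
- have p0 : 0 <= \prod_(x <- l') F x by rewrite prodr_ge0.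
  rewrite -nneseriesZl => [|k _]; last by rewrite mule_ge0 ?lee_fin// iexp_ge0.
  apply: eq_eseriesr => k _.
  transitivity (\int[P]_(w in A k) (h (k :: Ds s w))%:E)%E.
    by apply: eq_integral => w; rewrite inE /A /Ds /= => -[-> _].
  rewrite (IH (i :: s') (k :: l') _ (fun l => h (k :: l)))//= ?sl'//.
    by rewrite big_cons muleA -EFinM mulrC.
  by have := perm_catCA s [:: i] s' => /permPl/perm_uniq ->.
- by move=> k; exact: mDs.
- by apply: (dmeas_measurable_EFin _ h); exact: (mDs (i :: s)).
- by move=> w _; rewrite lee_fin.
- by move=> k k' _ _ [w []]; rewrite /A /Ds /= => -[-> _] [].
Qed.

Lemma expect_iid s (h : seq nat -> nat) : uniq s ->
  expect P (fun w => h (Ds s w)) = iexp F (size s) (fun l => (h l)%:R).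
Proof.
move=> us; have := integral_iid_in s [::] [::] (fun l => (h l)%:R).
rewrite cats0 big_nil mul1e => <-//.
by rewrite (_ : [set w | _] = setT)//; apply/seteqP; split.
Qed.

Lemma prob_iid s (b : seq nat -> bool) : uniq s ->
  P [set w | b (Ds s w)] = iexp F (size s) (fun l => (b l : nat)%:R).
Proof.
move=> us; rewrite -expect_bool; first exact: (expect_iid s (fun l => b l : nat)).
exact: (dmeas_comp b).
Qed.

Variable d : nat.

Definition excess (D' : int -> T -> nat) w v := (D' v w - d)%N.

Let a w v := excess D w v.

Let ma v : dmeas (fun w => a w v).
Proof. by apply: (dmeas_comp (fun x => (x - d)%N)); case: D_iid. Qed.

Variable m2 : R.
Hypothesis mean_sq : (mean F (fun k => (32 * (k - d))%:R ^+ 2)%R <= m2%:E)%E.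
Hypothesis mean_small : (mean F (fun k => (32 * (k - d))%:R)%R <= (2^-1)%:E)%E.

Let m2_ge0 : 0 <= m2.
Proof.
rewrite -lee_fin; apply: le_trans mean_sq; exact: mean_ge0.
Qed.

Let Wr (p : nat -> int) N w := lindley (mkseq (fun k => a w (p k)) N).

Lemma lindley_jump p N w : Wr p N w = lindley (jump d (Ds (mkseq p N) w)).
Proof. by rewrite /Wr /jump /Ds /mkseq -!map_comp. Qed.

Lemma dmeas_lindley p N : dmeas (Wr p N).
Proof. exact/(dmeas_comp lindley)/dmeas_map. Qed.

Lemma expect_lindley p N : injective p -> (expect P (Wr p N) <= (m2 + 1)%:E)%E.
Proof.
move=> ip; rewrite (_ : Wr p N = fun w => lindley (jump d (Ds (mkseq p N) w))).
  rewrite (expect_iid (mkseq p N) (fun l => lindley (jump d l))) ?mkseq_uniq//.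
  exact: iexp_lindley_le.
by apply/funext => w; exact: lindley_jump.
Qed.

Lemma expect_excess_lindley p N : injective p -> (forall k, p k != 0) ->
  (expect P (fun w => 32 * a w 0%R * Wr p N w)%N <= (2^-1 * (m2 + 1))%:E)%E.
Proof.
move=> ip p0; pose s := 0 :: mkseq p N.
have us : uniq s.
  rewrite /= mkseq_uniq// andbT; apply/mapP => -[k _] /eqP.
  by rewrite eq_sym (negbTE (p0 k)).
rewrite (_ : (fun w => _) = fun w => (fun l => (32 * (head 0 l - d) * lindley (jump d (behead l)))%N) (Ds s w)).
  rewrite (expect_iid s (fun l => 32 * (head 0 l - d) * lindley (jump d (behead l)))%N)//.
  under eq_iexp do rewrite natrM.
  apply: (iexp_cons_le _ _ _ (fun k => (32 * (k - d))%:R) (fun l => (lindley (jump d l))%:R)) => //.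
    by rewrite addr_ge0.
  exact: iexp_lindley_le.
by apply/funext => w; rewrite lindley_jump.
Qed.

Lemma expect_one (f : nat -> nat) : expect P (fun w => f (D 0 w)) = mean F (fun k => (f k)%:R).
Proof.
by rewrite (expect_iid [:: 0] (fun l => f (head 0 l)))//=; under eq_eseriesr do rewrite -EFinM.
Qed.

Lemma expect_excess : (expect P (fun w => 32 * a w 0%R)%N <= (2^-1)%:E)%E.
Proof. by rewrite (expect_one (fun k => 32 * (k - d))%N). Qed.

Lemma expect_excess_sq : (expect P (fun w => (32 * a w 0%R) ^ 2)%N <= m2%:E)%E.
Proof.
rewrite (expect_one (fun k => (32 * (k - d)) ^ 2)%N).
by rewrite /mean; under eq_eseriesr do rewrite natrX.
Qed.

Let reachD N w := reach (a w) N.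

Let pr (k : nat) : int := 1 + k%:Z.
Let pl (k : nat) : int := -1 - k%:Z.
Let pr_inj : injective pr. Proof. by move=> k k'; rewrite /pr; lia. Qed.
Let pl_inj : injective pl. Proof. by move=> k k'; rewrite /pl; lia. Qed.
Let pr0 k : pr k != 0. Proof. by rewrite /pr; lia. Qed.
Let pl0 k : pl k != 0. Proof. by rewrite /pl; lia. Qed.

Lemma dmeas_reach N : dmeas (reachD N).
Proof.
apply: (dmeas_comp2 addn); last exact: (dmeas_lindley pl).
apply: (dmeas_comp2 addn); first exact: (dmeas_lindley pr).
exact: (dmeas_comp (muln 32)).
Qed.

Lemma expect_reach N : (expect P (reachD N) <= (m2 + 1 + 2^-1 + (m2 + 1))%:E)%E.
Proof.
rewrite /reachD /reach expectD; last 2 first.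
- apply: (dmeas_comp2 addn); first exact: (dmeas_lindley pr).
  exact: (dmeas_comp (muln 32)).
- exact: (dmeas_lindley pl).
rewrite expectD; last 2 first.
- exact: (dmeas_lindley pr).
- exact: (dmeas_comp (muln 32)).
rewrite (EFinD (_ + 2^-1)) leeD//; last exact: (expect_lindley pl).
rewrite (EFinD (_ + 1)) leeD//; first exact: (expect_lindley pr).
exact: expect_excess.
Qed.

(** Multiplied by 32 a_0, both excursions factor by independence, and the middle term of [reach]
    becomes a square, bounded by [m2]. *)
Lemma expect_excess_reach N :
  (expect P (fun w => 32 * a w 0%R * reachD N w)%N
     <= (2^-1 * (m2 + 1) + m2 + 2^-1 * (m2 + 1))%:E)%E.
Proof.
have m32 : dmeas (fun w => 32 * a w 0%R)%N by exact: (dmeas_comp (muln 32)).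
rewrite (_ : (fun w => _) = fun w => (32 * a w 0%R * Wr pr N w + (32 * a w 0%R) ^ 2
    + 32 * a w 0%R * Wr pl N w)%N); last first.
  by apply/funext => w; rewrite /reachD /reach mulnDr mulnDr -mulnn.
have mr : dmeas (fun w => 32 * a w 0%R * Wr pr N w)%N.
  by apply: (dmeas_comp2 muln) => //; exact: dmeas_lindley.
have ml : dmeas (fun w => 32 * a w 0%R * Wr pl N w)%N.
  by apply: (dmeas_comp2 muln) => //; exact: dmeas_lindley.
have ms : dmeas (fun w => (32 * a w 0%R) ^ 2)%N by exact: (dmeas_comp (fun x => x ^ 2)%N).
rewrite expectD//; last exact: (dmeas_comp2 addn).
rewrite expectD// (EFinD (_ + m2)) leeD//; last exact: expect_excess_lindley.
rewrite (EFinD (2^-1 * _)) leeD//; first exact: expect_excess_lindley.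
exact: expect_excess_sq.
Qed.

Lemma dmeas_claimedb v : dmeas (fun w => claimedb (a w) v).
Proof.
apply: (dmeas_asbool (fun w => exists m, (1 <= m)%N /\ (m <= wsum (a w) v m)%N)).
apply: (mset_ex _ (fun m w => (1 <= m)%N /\ (m <= wsum (a w) v m)%N)) => m.
apply: mset_and; first exact: mset_Prop.
apply: (mset_pred (fun w => wsum (a w) v m) (fun x => (m <= x)%N)).
by apply: dmeas_sum => t.
Qed.

Definition half_claimed n w := (n <= 2 * nclaimed (a w) n)%N.

Lemma dmeas_half_claimed n : dmeas (half_claimed n).
Proof.
apply: (dmeas_comp (fun x => n <= 2 * x)%N); apply: dmeas_sum => k.
by apply: (dmeas_comp nat_of_bool); exact: dmeas_claimedb.
Qed.

(** Each n with half of 1..n claimed is at most [reach], so there are at most [reach] + 1 of them,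
    and the mean of this is at most 2 m2 + 7/2. *)
Lemma sum_half_claimed M :
  (\sum_(n < M) P [set w | half_claimed n w] <= (2 * m2 + 4)%:E)%E.
Proof.
under eq_bigr do rewrite -(expect_bool P _ (dmeas_half_claimed _)).
rewrite -expect_sum; last by move=> n; exact/(dmeas_comp nat_of_bool)/dmeas_half_claimed.
apply: (expect_monotone_bound P _ (fun N w => reachD N w + 1)%N).
- by apply: dmeas_sum => n; exact/(dmeas_comp nat_of_bool)/dmeas_half_claimed.
- by move=> N; apply: (dmeas_comp (fun x => x + 1)%N); exact: dmeas_reach.
- by move=> w n m nm; rewrite leq_add2r reach_mono.
- move=> w; elim: M => [|M [N IH]]; first by exists 0%N; rewrite big_ord0.
  have [hM|/negbTE hM] := boolP (half_claimed M w); last first.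
    by exists N; rewrite big_ord_recr /= hM addn0.
  have [N' hN'] := half_claimed_reach _ _ hM; exists N'.
  apply: leq_trans (_ : M.+1 <= _)%N; last by rewrite addn1 ltnS.
  rewrite -[X in (_ <= X)%N]card_ord -sum1_card.
  by apply: leq_sum => n _; case: half_claimed.
- move=> N; rewrite expectD; [|exact: dmeas_reach|exact: dmeas_cst].
  have -> : expect P (fun=> 1%N) = 1%:E.
    by rewrite /expect integral_cst// mul1e; exact: probability_setT.
  apply: le_trans (leeD2r _ (expect_reach N)) _.
  by rewrite -EFinD lee_fin; lra.
Qed.

End OneFamily.
End IIDFamily.

(** * Counts of unclaimed and of high vertices *)

(** Claims witnessed by radius at most [N]. They depend on finitely many vertices, as [iexp]
    requires, and increase to [claimedb]. *)
Definition claimed_upto (a : int -> nat) (N : nat) (i : int) : bool :=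
  [exists m : 'I_N.+1, (0 < m)%N && (m <= wsum a i m)%N].

Lemma claimed_upto_local a a' N i :
  (forall v, i - N%:Z <= v <= i + N%:Z -> a v = a' v) ->
  claimed_upto a N i = claimed_upto a' N i.
Proof.
move=> aa; apply: eq_existsb => m; congr (_ && (_ <= _)%N).
apply: eq_bigr => t _; apply: aa.
have := ltn_ord m; have := ltn_ord t; lia.
Qed.

Lemma claimed_upto0 a N i : (0 < N)%N -> ~~ claimed_upto a N i -> a i = 0%N.
Proof.
move=> N0 /existsPn /(_ (inord 1)); rewrite inordK//= -ltnNge ltnS leqn0.
rewrite /wsum sum_nat_eq0 => /forallP /(_ (inord 1)) /=.
rewrite inordK// => /eqP; rewrite (_ : i - 1%:Z + 1%:Z = i)//; lia.
Qed.

Lemma claimed_upto_claimedb a i : exists N0, forall N, (N0 <= N)%N ->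
  claimed_upto a N i = claimedb a i.
Proof.
have [hc|hc] := boolP (claimedb a i).
  have /asboolP[m [m0 hm]] := hc; exists m => N mN.
  by apply/existsP; exists (inord m); rewrite inordK// m0.
exists 0%N => N _; apply/negbTE/existsPn => m; apply: contra hc => /andP[m0 hm].
by apply/asboolP; exists m.
Qed.

Lemma claimed_upto_claimedb_seq a (p : nat -> int) n : exists N0, forall N, (N0 <= N)%N ->
  forall k, (k < n)%N -> claimed_upto a N (p k) = claimedb a (p k).
Proof.
elim: n => [|n [N0 IH]]; first by exists 0%N.
have [N1 h1] := claimed_upto_claimedb a (p n).
exists (maxn N0 N1) => N; rewrite geq_max => /andP[h h'] k.
by rewrite ltnS leq_eqVlt => /predU1P[->|/IH]; [exact: h1|exact].
Qed.

(** * Exponential tail bounds for vertex counts *)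

Section Tails.
Context {R : realType}.

Lemma sum_geometric_half (rho : R) M : 0 <= rho -> rho < 1 ->
  \sum_(n < M) rho ^+ n./2 <= 2 / (1 - rho).
Proof.
move=> r0 r1; rewrite ler_pdivlMr ?subr_gt0//.
(* Even and odd n form two geometric series; this closed form telescopes for both parities of M. *)
have -> : (\sum_(n < M) rho ^+ n./2) * (1 - rho) = 2 - rho ^+ M./2 - rho ^+ uphalf M.
  elim: M => [|M IH]; first by rewrite big_ord0 mul0r !expr0; ring.
  by rewrite big_ord_recr /= mulrDl IH exprS; ring.
by rewrite -addrA gerDl -opprD oppr_le0 addr_ge0 ?exprn_ge0.
Qed.

Lemma sum_geometric (rho : R) M : 0 <= rho -> rho < 1 ->
  \sum_(n < M) rho ^+ n <= 1 / (1 - rho).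
Proof.
move=> r0 r1; rewrite ler_pdivlMr ?subr_gt0//.
have -> : (\sum_(n < M) rho ^+ n) * (1 - rho) = 1 - rho ^+ M.
  elim: M => [|M IH]; first by rewrite big_ord0 mul0r !expr0; ring.
  by rewrite big_ord_recr /= mulrDl IH exprS; ring.
by rewrite gerBl exprn_ge0.
Qed.

Context {dm : measure_display} {T : measurableType dm}.
Variables (P : probability T R) (F : nat -> R).
Hypothesis F_ge0 : forall n, 0 <= F n.
Hypothesis F_sum1 : (\sum_(0 <= n <oo) (F n)%:E = 1)%E.
Variable D : int -> T -> nat.
Hypothesis D_iid : iid P F D.
Variable d : nat.

Let a w v := excess d D w v.

Definition halve (q : nat -> bool) (x : nat) : R := if q x then 2^-1 else 1.

Lemma prod_halve (I : Type) (s : seq I) (u : pred I) (q : nat -> bool) (f : I -> nat) (c : R) :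
  \prod_(i <- s) (if u i then halve q (f i) / c else 1) =
  (2^-1) ^+ (\sum_(i <- s) (u i && q (f i)))%N * c^-1 ^+ (\sum_(i <- s) u i)%N.
Proof.
elim: s => [|i s IH]; first by rewrite !big_nil !expr0 mulr1.
rewrite !big_cons IH !exprD /halve; case: (u i) => /=; last by rewrite !expr0; ring.
by case: (q _); rewrite /= ?expr0 ?expr1; ring.
Qed.

(* [1{q < K} <= 2^K 2^-q] turns the tail bounds into products of independent factors. *)
Lemma pow2_half_ge1 (K q : nat) : (q < K)%N -> 1 <= 2 ^+ K * (2^-1) ^+ q :> R.
Proof.
move=> qK; rewrite exprVn -expfB// exprn_ege1//; lra.
Qed.

Section Unclaimed.
Variables (j K : nat) (rho : R).
Hypothesis rho_gt0 : 0 < rho.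
Hypothesis rho_le1 : rho <= 1.
Hypothesis rho_sum : \sum_(0 <= k < d.+1) F k * halve (leq j) k = rho * \sum_(0 <= k < d.+1) F k.

Definition few_unclaimed (cl : T -> int -> bool) n w :=
  (n <= 2 * \sum_(k < n) ~~ cl w (1 + k%:Z)%R)%N &&
  (\sum_(k < n) (~~ cl w (1 + k%:Z)%R && (j <= D (1 + k%:Z)%R w)) < K)%N.

(** An exponential Markov bound. Each unclaimed vertex gets the weight [halve] divided by [rho], the
    mean of [halve] given degree at most [d]; by [iexp_weight] the product has expectation 1.
    Undoing the normalisation costs a factor [rho] per unclaimed vertex, of which there are at least
    n/2. *)
Lemma prob_few_unclaimed_upto n N : (0 < N)%N ->
  (P [set w | few_unclaimed (fun w => claimed_upto (a w) N) n w]
     <= (2 ^+ K * rho ^+ n./2)%:E)%E.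
Proof.
move=> N0.
(* The block from 1 - N to n + N contains every window of radius at most N around 1..n. *)
pose L := (N + (n + N))%N.
pose p (t : nat) : int := 1 - N%:Z + t%:Z.
pose s := mkseq p L.
pose pos (al : seq nat) (v : int) := nth 0%N al (absz (v - (1 - N%:Z))%R).
pose cl al (k : nat) := claimed_upto (pos al) N (1 + k%:Z).
pose b l := (n <= 2 * \sum_(k < n) ~~ cl (jump d l) k)%N &&
  (\sum_(k < n) (~~ cl (jump d l) k && (j <= nth 0%N l (N + k))) < K)%N.
have -> : [set w | few_unclaimed (fun w => claimed_upto (a w) N) n w] =
    [set w | b [seq D i w | i <- s]].
  apply: eq_set => w; rewrite /few_unclaimed /b.
  have hD (t : nat) : (t < L)%N -> nth 0%N [seq D i w | i <- s] t = D (p t) w.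
    by move=> tL; rewrite (nth_map 0) ?size_map ?size_iota// nth_mkseq.
  have ecl (k : 'I_n) : cl (jump d [seq D i w | i <- s]) k = claimed_upto (a w) N (1 + k%:Z).
    apply: claimed_upto_local => v hv; rewrite /pos /jump.
    have hk := ltn_ord k; have h1 : (absz (v - (1 - N%:Z))%R < L)%N by rewrite /L; lia.
    rewrite (nth_map 0%N) ?size_map ?size_iota// hD// /a /excess; congr (D _ w - _)%N.
    rewrite /p; lia.
  have eD (k : 'I_n) : nth 0%N [seq D i w | i <- s] (N + k) = D (1 + k%:Z) w.
    have hk := ltn_ord k; rewrite hD; first by congr (D _ w); rewrite /p; lia.
    by rewrite /L; lia.
  under [in RHS]eq_bigr do rewrite ecl.
  by under [X in _ = is_true (_ && (X < _)%N)]eq_bigr do rewrite ecl eD.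
have us : uniq s by apply: mkseq_uniq => x y; rewrite /p; lia.
rewrite (prob_iid P F F_ge0 D D_iid s b us) size_mkseq.
pose psi x : R := halve (leq j) x / rho.
pose S al t := [&& (N <= t)%N, (t < N + n)%N & ~~ cl al (t - N)%N].
have psi0 x : 0 <= psi x.
  by rewrite /psi /halve divr_ge0 ?(ltW rho_gt0)//; case: ifP.
have c0 : 0 <= 2 ^+ K * rho ^+ n./2 by rewrite mulr_ge0 ?exprn_ge0 ?ltW.
have pr0 l : 0 <= \prod_(t < L) (if S (jump d l) t then psi (nth 0%N l t) else 1).
  by rewrite prodr_ge0// => t _; case: ifP.
apply: (@le_trans _ _ (iexp F L (fun l => (2 ^+ K * rho ^+ n./2) *
   \prod_(t < L) (if S (jump d l) t then psi (nth 0%N l t) else 1)))).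
  apply: le_iexp => // l sl.
  have [/andP[h1 h2]|_] := boolP (b l); last by rewrite mulr_ge0.
  (* Only the n middle coordinates carry weights; the two margins of length N contribute 1. *)
  rewrite big_split_ord /= big1 ?mul1r; last first.
    by move=> t _; rewrite /S leqNgt ltn_ord.
  rewrite big_split_ord /= [X in _ * (_ * X)]big1 ?mulr1; last first.
    by move=> t _; rewrite /S leq_addr ltn_add2l ltnNge leq_addr.
  under eq_bigr => t _ do rewrite /S leq_addr ltn_add2l ltn_ord /= addKn.
  rewrite prod_halve mulrACA mulr_ege1//; first exact: pow2_half_ge1.
  rewrite exprVn ler_pdivlMr ?exprn_gt0// mul1r ler_wiXn2l ?(ltW rho_gt0)//.
  by rewrite -leq_double -[leqRHS]mul2n (leq_trans _ h1)// -[leqRHS]odd_double_half leq_addl.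
rewrite iexpZ// -[leRHS]mule1 lee_wpmul2l ?lee_fin//.
have := iexp_weight F F_ge0 d psi psi0 _ L (fun=> 1) S.
under eq_iexp do rewrite mul1r.
rewrite iexp_cst// => -> //.
- rewrite /psi; under eq_bigr do rewrite mulrA.
  by rewrite -mulr_suml rho_sum mulrAC divff ?gt_eqF// mul1r.
(* Side condition of [iexp_weight]: radius 1 already claims every vertex with positive excess, so an
   unclaimed one has zero jump. *)
- move=> al t /and3P[Nt tn /(claimed_upto0 _ _ _ N0)] + tal.
  by rewrite /pos => e; rewrite -[RHS]e; congr (nth _ _ _); lia.
Qed.

Lemma prob_few_unclaimed n :
  (P [set w | few_unclaimed (fun w => claimedb (a w)) n w]
     <= (2 ^+ K * rho ^+ n./2)%:E)%E.
Proof.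
have mD v : dmeas (D v) by case: D_iid.
have ma v : dmeas (fun w => a w v) by apply: (dmeas_comp (fun x => (x - d)%N)).
have mfew cl : (forall v, dmeas (fun w => cl w v)) -> dmeas (few_unclaimed cl n).
  move=> mcl; apply: (dmeas_comp2 andb).
    apply: (dmeas_comp (fun x => n <= 2 * x)%N); apply: dmeas_sum => k.
    by apply: (dmeas_comp (fun b => nat_of_bool (~~ b))).
  apply: (dmeas_comp (fun x => x < K)%N); apply: dmeas_sum => k.
  by apply: (dmeas_comp2 (fun b x => nat_of_bool (~~ b && (j <= x)%N))).
have mup N : dmeas (few_unclaimed (fun w => claimed_upto (a w) N) n).
  apply: mfew => v.
  pose Q w (m : 'I_N.+1) := (0 < m)%N /\ (m <= wsum (a w) v m)%N.
  apply: (eq_dmeas (fun w => `[< exists m, Q w m >])).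
    by move=> w; apply/asboolP/existsP => -[m /andP ?]; exists m.
  apply: (dmeas_asbool (fun w => exists m, Q w m)).
  apply: mset_ex => m; apply: mset_and; first exact: mset_Prop.
  apply: (mset_pred (fun w => wsum (a w) v m) (fun x => (m <= x)%N)).
  by apply: dmeas_sum => t.
have mcl : dmeas (few_unclaimed (fun w => claimedb (a w)) n).
  by apply: mfew => v; exact: (dmeas_claimedb P F).
rewrite -(expect_bool _ _ mcl).
(* These events increase in N and exhaust the event with true claims, while each lies in a truncated
   event with the same bound. The shift [M.+1] keeps the radius positive. *)
pose Q N w := forall M, (N <= M)%N -> few_unclaimed (fun w => claimed_upto (a w) M.+1) n w.
have mQ N : dmeas (fun w => `[< Q N w >]).
  apply: dmeas_asbool; apply: mset_all => M; apply: mset_imply => _.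
  exact/mset_bool/mup.
apply: (expect_monotone_bound P _ (fun N w => `[< Q N w >] : nat)).
- exact: (dmeas_comp nat_of_bool).
- by move=> N; exact: (dmeas_comp nat_of_bool).
- move=> w N M NM; case: (asboolP (Q N w)) => // h.
  by rewrite (asboolT _)// => M' MM'; apply: h; exact: leq_trans MM'.
- move=> w; case: (boolP (few_unclaimed _ n w)) => [h|_]; last by exists 0%N.
  have [N0 hN0] := claimed_upto_claimedb_seq (a w) (fun k => 1 + k%:Z) n.
  exists N0; rewrite lt0b; apply/asboolP => M N0M.
  move: h; rewrite /few_unclaimed.
  have e (k : 'I_n) : claimed_upto (a w) M.+1 (1 + k%:Z) = claimedb (a w) (1 + k%:Z).
    by apply: hN0 => //; exact: leqW.
  by under [in X in _ -> X]eq_bigr do rewrite e; under [X in _ -> _ && (X < _)%N]eq_bigr do rewrite e.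
- move=> N; rewrite (expect_bool _ _ (mQ N)).
  apply: le_trans (prob_few_unclaimed_upto n N.+1 _) => //.
  apply: le_measure; rewrite ?inE.
  + exact/mset_bool/mQ.
  + exact/mset_bool/mup.
  + by move=> w /= /asboolP /(_ N (leqnn _)).
Qed.

Variable m2 : R.
Hypothesis mean_sq : (mean F (fun k => (32 * (k - d))%:R ^+ 2)%R <= m2%:E)%E.
Hypothesis mean_small : (mean F (fun k => (32 * (k - d))%:R)%R <= (2^-1)%:E)%E.
Hypothesis rho_lt1 : rho < 1.

Definition unclaimed_count n w : nat :=
  \sum_(k < n) (~~ claimedb (a w) (1 + k%:Z)%R && (j <= D (1 + k%:Z)%R w)).

Lemma dmeas_unclaimed_count n : dmeas (unclaimed_count n).
Proof.
apply: dmeas_sum => k.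
apply: (dmeas_comp2 (fun b x => nat_of_bool (~~ b && (j <= x)%N))).
  exact: (dmeas_claimedb P F).
by case: D_iid.
Qed.

(** If half of 1..n is not claimed, more than half is unclaimed, so a small count falls under one of
    two summable bounds. *)
Lemma sum_unclaimed_count M :
  (\sum_(n < M) P [set w | unclaimed_count n w < K]%N
    <= (2 * m2 + 4 + 2 ^+ K * (2 / (1 - rho)))%:E)%E.
Proof.
have mh n : dmeas (half_claimed D d n) by exact: (dmeas_half_claimed P F).
have mu n : measurable [set w | (unclaimed_count n w < K)%N].
  by apply: (mset_pred _ (fun x => (x < K)%N)); exact: dmeas_unclaimed_count.
apply: (@le_trans _ _ (\sum_(n < M) (P [set w | half_claimed D d n w] +
    (2 ^+ K * rho ^+ n./2)%:E))%E).
  apply: lee_sum => n _.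
  have mf : measurable [set w | few_unclaimed (fun w => claimedb (a w)) n w].
    have mc v : dmeas (fun w => claimedb (a w) v) by exact: (dmeas_claimedb P F).
    apply: mset_bool; apply: (dmeas_comp2 andb).
      apply: (dmeas_comp (fun x => n <= 2 * x)%N); apply: dmeas_sum => k.
      by apply: (dmeas_comp (fun b => nat_of_bool (~~ b))).
    by apply: (dmeas_comp (fun x => x < K)%N); exact: dmeas_unclaimed_count.
  apply: le_trans (leeD2l _ (prob_few_unclaimed n)).
  apply: le_trans (measureU2 _ _ _); [|exact/mset_bool/mh|exact: mf].
  apply: le_measure; rewrite ?inE//.
    by apply: measurableU => //; exact/mset_bool/mh.
  move=> w /= huc; have [hh|hh] := boolP (half_claimed D d n w); first by left.
  right; rewrite /few_unclaimed [X in _ && X]huc andbT.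
  have {}hh : (2 * nclaimed (a w) n < n)%N by rewrite ltnNge.
  suff : (nclaimed (a w) n + \sum_(k < n) ~~ claimedb (a w) (1 + k%:Z)%R = n)%N.
    by set x := nclaimed _ _ in hh *; set y := bigop.body _ _ _; lia.
  rewrite /nclaimed -big_split /= -[RHS]card_ord -sum1_card; apply: eq_bigr => k _.
  by case: claimedb.
rewrite big_split /= EFinD leeD//; first exact: (sum_half_claimed P F).
rewrite sumEFin lee_fin -mulr_sumr ler_wpM2l ?exprn_ge0//.
by apply: sum_geometric_half => //; exact: ltW.
Qed.

End Unclaimed.

(** Being high is a property of the single degree, so the product of weights factors directly and
    [rho] is an unconditional mean. *)
Lemma sum_high_count K (rho : R) M : 0 <= rho -> rho < 1 ->
  mean F (halve (fun x => (d < x)%N)) = rho%:E ->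
  (\sum_(n < M) P [set w | (\sum_(k < n) (d < D (1 + k%:Z)%R w) < K)%N]
    <= (2 ^+ K * (1 / (1 - rho)))%:E)%E.
Proof.
move=> r0 r1 hr; apply: (@le_trans _ _ (\sum_(n < M) (2 ^+ K * rho ^+ n)%:E)%E).
  apply: lee_sum => n _.
  pose s := mkseq (fun k => 1 + k%:Z : int) n.
  have us : uniq s by apply: mkseq_uniq => x y; lia.
  pose b (l : seq nat) := (\sum_(x <- l) (d < x) < K)%N.
  have -> : [set w | (\sum_(k < n) (d < D (1 + k%:Z)%R w) < K)%N] =
      [set w | b [seq D i w | i <- s]].
    apply: eq_set => w; rewrite /b /s /mkseq -map_comp big_map.
    by rewrite -(big_mkord xpredT (fun k => nat_of_bool (d < D (1 + k%:Z)%R w)%N)) /index_iota subn0.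
  rewrite (prob_iid P F F_ge0 D D_iid s b us) size_mkseq.
  have h0 x : 0 <= halve (fun x => (d < x)%N) x by rewrite /halve; case: ifP.
  rewrite EFinM -(iexp_prod F F_ge0 _ _ n h0 r0 hr) -iexpZ ?exprn_ge0//; last first.
    by move=> l; rewrite prodr_ge0.
  apply: le_iexp => // l _.
  have [hb|_] := boolP (b l); last by rewrite mulr_ge0 ?exprn_ge0// prodr_ge0.
  rewrite (_ : \prod_(x <- l) _ = 2^-1 ^+ (\sum_(x <- l) (d < x))%N); first exact: pow2_half_ge1.
  elim: (l) => [|x l' IH]; first by rewrite !big_nil.
  by rewrite !big_cons exprD IH /halve; case: (d < x)%N; rewrite /= ?expr1 ?expr0.
rewrite sumEFin lee_fin -mulr_sumr ler_wpM2l ?exprn_ge0//.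
exact: sum_geometric.
Qed.

End Tails.

(** * Quantile transform *)

Section Quantile.
Context {R : realType}.
Variable F : nat -> R.
Hypothesis F_ge0 : forall n, 0 <= F n.
Hypothesis F_sum1 : (\sum_(0 <= n <oo) (F n)%:E = 1)%E.
Hypothesis F0 : F 0%N = 0.

Let S (u : R) : set nat := [set n | u <= cdfF F n /\ forall m, (m < n)%N -> cdfF F m < u].

Let S_uniq u n m : S u n -> S u m -> n = m.
Proof.
move=> [un hn] [um hm]; case: (ltngtP n m) => // h.
  by have := hm _ h; rewrite ltNge un.
by have := hn _ h; rewrite ltNge um.
Qed.

Lemma cdfF_mono n m : (n <= m)%N -> cdfF F n <= cdfF F m.
Proof.
move=> nm; rewrite -(subnKC nm); elim: (m - n)%N => [|k IH]; first by rewrite addn0.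
by rewrite addnS (le_trans IH)// /cdfF [leRHS]big_nat_recr//= lerDl.
Qed.

Lemma cdfF_itv n : 0 <= cdfF F n <= 1.
Proof.
rewrite /cdfF sumr_ge0//= -lee_fin -sumEFin -F_sum1.
by apply: nneseries_lim_ge => k _ _; rewrite lee_fin.
Qed.

Lemma quantileS u n : quantile F u = n.+1 <-> cdfF F n < u <= cdfF F n.+1.
Proof.
rewrite /quantile; split.
  case: xgetP => // m -> [um hm] e; move: hm um; rewrite e => hm um.
  by rewrite um hm.
move=> /andP[un un1].
have Sn : S u n.+1.
  by split=> // m; rewrite ltnS => mn; apply: le_lt_trans un; exact: cdfF_mono.
by case: xgetP => [m -> Sm|/(_ n.+1)//]; exact: S_uniq Sm Sn.
Qed.

Lemma dmeas_quantile : dmeas (quantile F).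
Proof.
apply: dmeas_xget => [u n m|n]; first exact: S_uniq.
apply: mset_and.
  rewrite (_ : [set _ | _] = [set` `]-oo, cdfF F n]]); first exact: measurable_itv.
  by apply/seteqP; split => u /=; rewrite in_itv.
apply: mset_all => m; apply: mset_imply => _.
rewrite (_ : [set _ | _] = [set` `]cdfF F m, +oo[]); first exact: measurable_itv.
by apply/seteqP; split => u /=; rewrite in_itv /= andbT.
Qed.

Section Law.
Context {dm : measure_display} {T : measurableType dm}.
Variable P : probability T R.

Lemma dmeas_quantile_comp (Y : T -> R) : measurable_fun setT Y ->
  dmeas (fun w => quantile F (Y w)).
Proof. by move=> mY n; rewrite -[X in measurable X]setTI; exact: mY (dmeas_quantile n). Qed.

Lemma quantile_law (Y : T -> R) n : uniform01_rv P Y ->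
  P [set w | quantile F (Y w) = n] = (F n)%:E.
Proof.
move=> [mY hY].
have mq := dmeas_quantile_comp Y mY.
have mle x : measurable [set w | Y w <= x].
  rewrite -[X in measurable X]setTI (_ : [set w | _] = Y @^-1` [set` `]-oo, x]]).
    exact: mY.
  by apply/seteqP; split => u /=; rewrite in_itv.
have hS k : P [set w | quantile F (Y w) = k.+1] = (F k.+1)%:E.
  rewrite (_ : [set _ | _] = [set w | Y w <= cdfF F k.+1] `\` [set w | Y w <= cdfF F k]).
    rewrite measureD//; last first.
      by rewrite ltey_eq fin_num_measure.
    rewrite setIidr; last by move=> w /= h; apply: le_trans h (cdfF_mono _ _ _).
    rewrite [X in (X - _)%E](hY _ (cdfF_itv _)) [X in (_ - X)%E](hY _ (cdfF_itv _)) -EFinB; congr EFin.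
    by rewrite /cdfF big_nat_recr//= addrAC subrr add0r.
  apply/seteqP; split => w /=; first by move/quantileS/andP => [h ->]; rewrite leNgt h.
  by move=> [h1 /negP]; rewrite -ltNge => h2; apply/quantileS; rewrite h1 h2.
(* The value 0 is also the default of [xget] when no n qualifies, so its probability is found as the
   complement of the others rather than from an interval. *)
case: n => [|n]; last exact: hS.
have h1 : (1 = \sum_(0 <= k <oo) P [set w | quantile F (Y w) = k])%E.
  pose A k := [set w | quantile F (Y w) = k].
  have tA : trivIset setT A by move=> i j _ _ [w [/= <- <-]].
  have := measure_bigcup P setT A (fun k _ => mq k) tA.
  rewrite (@eq_eseriesl _ _ xpredT) => [<-|k]; last by rewrite in_setT.
  rewrite -(probability_setT P); congr (P _).
  by apply/seteqP; split => w // _; exists (quantile F (Y w)).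
have hrec (f : nat -> \bar R) : (forall k, 0 <= f k)%E ->
  (\sum_(0 <= k <oo) f k = f 0%N + \sum_(0 <= k <oo) f k.+1)%E.
  move=> f0; rewrite nneseries_recl//; congr (_ + _)%E.
  by rewrite -(nneseries_addn 1)//; apply: eq_eseriesr => k _; rewrite addn1.
move: h1; rewrite hrec//.
under eq_eseriesr do rewrite hS.
have : (\sum_(0 <= k <oo) (F k.+1)%:E = 1)%E.
  by rewrite -F_sum1 [RHS]hrec ?F0 ?add0e// => k; rewrite lee_fin.
move=> -> h; rewrite F0; move: h.
have : P [set w | quantile F (Y w) = 0%N] \is a fin_num by rewrite fin_num_measure.
by case: (P _) => // r _ /eqP; rewrite -EFinD eqe => /eqP h; congr EFin; lra.
Qed.

Lemma iid_quantile (U : Src -> T -> R) :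
  (forall s, uniform01_rv P (U s)) -> mutually_independent P U ->
  iid P F (fun i w => quantile F (U (SDeg i) w)).
Proof.
move=> hU ind; split=> [i|s l us sl].
  by apply: dmeas_quantile_comp; case: (hU (SDeg i)).
pose f (k : 'I_(size s)) := SDeg (nth 0 s k).
pose B (k : 'I_(size s)) := [set u | quantile F u = nth 0%N l k].
have finj : injective f.
  by move=> k k' [] /eqP; rewrite nth_uniq// => /eqP/val_inj.
have := ind _ f B finj (fun k => dmeas_quantile _).
rewrite (_ : [set _ | _] = [set w | [seq quantile F (U (SDeg i) w) | i <- s] = l]).
  move=> ->; transitivity (\prod_(k < size s) (F (nth 0%N l k))%:E)%E.
    by apply: eq_bigr => k _; exact: quantile_law.
  by rewrite (big_nth 0%N) big_mkord sl prodEFin.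
apply/seteqP; split => w /=.
  move=> h; apply: (@eq_from_nth _ 0%N); rewrite ?size_map// => k ks.
  by rewrite (nth_map 0)//; exact: (h (Ordinal ks)).
by move=> e k; rewrite /B /f /= -e (nth_map 0).
Qed.

End Law.
End Quantile.

(** * Measurability of the model *)

Lemma count_map_iota (p : int -> bool) (f : nat -> int) m :
  count p [seq f t | t <- iota 1 m] = (\sum_(t < m) p (f t.+1))%N.
Proof.
elim: m => [|m IH]; first by rewrite big_ord0.
by rewrite big_ord_recr -IH -{1}(addn1 m) iotaD map_cat count_cat /= addn0 add1n.
Qed.

Definition is_kth_right (p : int -> bool) i k : set int :=
  [set v | i < v /\ p v /\ count p [seq i + t%:Z | t <- iota 1 (`|v - i|%N).-1] = k.-1].

Definition is_kth_left (p : int -> bool) i k : set int :=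
  [set v | v < i /\ p v /\ count p [seq v + t%:Z | t <- iota 1 (`|i - v|%N).-1] = k.-1].

Lemma is_kth_rightE p i k v : is_kth_right p i k v ->
  exists n, [/\ v = i + n.+1%:Z, p v & (\sum_(t < n) p (i + t.+1%:Z)%R)%N = k.-1].
Proof.
move=> [iv [pv hc]]; exists (`|v - i|%N).-1; split=> //; first by lia.
by rewrite -hc count_map_iota.
Qed.

Lemma is_kth_leftE p i k v : is_kth_left p i k v ->
  exists n, [/\ v = i - n.+1%:Z, p v & (\sum_(t < n) p (i - t.+1%:Z)%R)%N = k.-1].
Proof.
move=> [iv [pv hc]]; exists (`|i - v|%N).-1; split=> //; first by lia.
rewrite -hc count_map_iota (reindex_inj rev_ord_inj) /=; apply: eq_bigr => t _.
by congr (nat_of_bool (p _)); have := ltn_ord t; lia.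
Qed.

Lemma sum_bool_le (q : nat -> bool) n m : (n <= m)%N ->
  (\sum_(t < n) q t <= \sum_(t < m) q t)%N.
Proof. by move=> nm; rewrite -(subnKC nm) big_split_ord leq_addr. Qed.

Lemma sum_bool_lt (q : nat -> bool) n m : (n < m)%N -> q n ->
  (\sum_(t < n) q t < \sum_(t < m) q t)%N.
Proof.
move=> nm qn; apply: leq_trans (sum_bool_le q _ _ nm).
by rewrite big_ord_recr /= qn addn1.
Qed.

Lemma kth_uniq (q : nat -> bool) n m : q n -> q m ->
  (\sum_(t < n) q t = \sum_(t < m) q t)%N -> n = m.
Proof.
move=> qn qm e; case: (ltngtP n m) => // h.
  by have := sum_bool_lt q _ _ h qn; rewrite e ltnn.
by have := sum_bool_lt q _ _ h qm; rewrite e ltnn.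
Qed.

Lemma is_kth_right_uniq p i k v v' : is_kth_right p i k v -> is_kth_right p i k v' -> v = v'.
Proof.
move=> /is_kth_rightE[n [-> pn hn]] /is_kth_rightE[m [-> pm hm]].
by rewrite (kth_uniq (fun t => p (i + t.+1%:Z)) n m)// hn hm.
Qed.

Lemma is_kth_left_uniq p i k v v' : is_kth_left p i k v -> is_kth_left p i k v' -> v = v'.
Proof.
move=> /is_kth_leftE[n [-> pn hn]] /is_kth_leftE[m [-> pm hm]].
by rewrite (kth_uniq (fun t => p (i - t.+1%:Z)) n m)// hn hm.
Qed.

(** If there is no k-th vertex the default is 0, at distance 0, which contradicts the assumption.
    Otherwise the k-th vertex lies beyond n, so 1..n holds at most k - 1. *)
Lemma kth_right_far p k n : (0 < k)%N -> (n < `|kth_right p 0 k|)%N ->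
  (\sum_(t < n) p (1 + t%:Z)%R < k)%N.
Proof.
move=> k0; rewrite /kth_right; case: xgetP => [v -> /is_kth_rightE[m [-> _ hm]]|_] // nm.
apply: (@leq_ltn_trans (\sum_(t < m) p (0 + t.+1%:Z)%R)%N); last by rewrite hm prednK.
apply: leq_trans (sum_bool_le (fun t => p (0 + t.+1%:Z)) _ _ (_ : n <= m)%N); last by lia.
by apply: leq_sum => t _; rewrite (_ : 1 + t%:Z = 0 + t.+1%:Z)//; lia.
Qed.

Lemma kth_left_far p k n : (0 < k)%N -> (n < `|kth_left p 0 k|)%N ->
  (\sum_(t < n) p (- (1 + t%:Z))%R < k)%N.
Proof.
move=> k0; rewrite /kth_left; case: xgetP => [v -> /is_kth_leftE[m [-> _ hm]]|_] // nm.
apply: (@leq_ltn_trans (\sum_(t < m) p (0 - t.+1%:Z)%R)%N); last by rewrite hm prednK.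
apply: leq_trans (sum_bool_le (fun t => p (0 - t.+1%:Z)) _ _ (_ : n <= m)%N); last by lia.
by apply: leq_sum => t _; rewrite sub0r.
Qed.

Section ModelMeasurability.
Context {R : realType} {dm : measure_display} {T : measurableType dm}.
Variables (F : nat -> R) (U : Src -> T -> R) (d : nat).
Hypothesis F_ge0 : forall n, 0 <= F n.
Hypothesis U_meas : forall s, measurable_fun setT (U s).

Let c w := cfg_of F U w.

Lemma dmeas_cD i : dmeas (fun w => cD (c w) i).
Proof. exact: dmeas_quantile_comp. Qed.

Lemma mset_le s s' : measurable [set w | U s w <= U s' w].
Proof.
rewrite -[X in measurable X]setTI.
exact: measurable_fun_le.
Qed.

Lemma mset_lt s s' : measurable [set w | U s w < U s' w].
Proof.
rewrite (_ : [set _ | _] = [set w | ~ (U s' w <= U s w)]); first exact/mset_not/mset_le.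
by apply/seteqP; split => w /=; rewrite ltNge => /negP.
Qed.

Lemma dmeas_lab_le u v : dmeas (fun w => lab_le (c w) u v).
Proof.
apply: (eq_dmeas (fun w => `[< U (SLab u) w < U (SLab v) w \/
   ((U (SLab u) w <= U (SLab v) w /\ U (SLab v) w <= U (SLab u) w) /\ u <= v) >])).
  move=> w; rewrite /lab_le /c /=; apply/asboolP/orP.
    by case=> [->|[/andP h ->]]; [left|right; rewrite eq_le h].
  by case=> [->|/andP[/eqP-> ->]]; [left|right].
apply: dmeas_asbool; apply: mset_or; first exact: mset_lt.
by apply: mset_and; [apply: mset_and; exact: mset_le|exact: mset_Prop].
Qed.

Lemma dmeas_coin s : dmeas (fun w => U s w < 2^-1).
Proof.
apply: (eq_dmeas (fun w => `[< U s w < 2^-1 >])); first by move=> w; rewrite asboolb.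
apply: dmeas_asbool.
rewrite -[X in measurable X]setTI (_ : [set w | _] = U s @^-1` [set` `]-oo, 2^-1[]).
  exact: U_meas.
by apply/seteqP; split => u /=; rewrite in_itv.
Qed.

Lemma dmeas_Dd i : dmeas (fun w => Dd d (c w) i).
Proof. exact/(dmeas_comp (fun x => x - d)%N)/dmeas_cD. Qed.

Lemma dmeas_high i : dmeas (fun w => high d (c w) i).
Proof. exact/(dmeas_comp (fun x => d < x)%N)/dmeas_cD. Qed.

Lemma mset_claimed i : measurable [set w | claimed d (c w) i].
Proof.
apply: mset_ex => m; apply: mset_and; first exact: mset_Prop.
apply: (mset_pred (fun w => window_sum d (c w) i m) (fun x => (m <= x)%N)).
by apply: dmeas_sum => t; exact: dmeas_Dd.
Qed.

Lemma mset_cluster_of i k : measurable [set w | cluster_of d (c w) i k].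
Proof.
apply: mset_all => j; apply: mset_imply => _; exact: mset_claimed.
Qed.

(** For two left ends u < v, the vertex v - 1 would lie between i and v or between u and i, hence be
    claimed. *)
Lemma cl_left_uniq w i x y :
  cluster_of d (c w) i x /\ ~ claimed d (c w) (x - 1) ->
  cluster_of d (c w) i y /\ ~ claimed d (c w) (y - 1) -> x = y.
Proof.
suff le u v : cluster_of d (c w) i u /\ ~ claimed d (c w) (u - 1) ->
  cluster_of d (c w) i v /\ ~ claimed d (c w) (v - 1) -> v <= u.
  by move=> hx hy; apply/eqP; rewrite eq_le (le _ _ hx hy) (le _ _ hy hx).
move=> [cu nu] [cv nv]; rewrite leNgt; apply/negP => uv.
have [iv|vi] := leP i (v - 1).
  by apply: nv; apply: cv; rewrite /between; lia.
by apply: nv; apply: cu; rewrite /between; lia.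
Qed.

Lemma cl_right_uniq w i x y :
  cluster_of d (c w) i x /\ ~ claimed d (c w) (x + 1) ->
  cluster_of d (c w) i y /\ ~ claimed d (c w) (y + 1) -> x = y.
Proof.
suff le u v : cluster_of d (c w) i u /\ ~ claimed d (c w) (u + 1) ->
  cluster_of d (c w) i v /\ ~ claimed d (c w) (v + 1) -> u <= v.
  by move=> hx hy; apply/eqP; rewrite eq_le (le _ _ hx hy) (le _ _ hy hx).
move=> [cu nu] [cv nv]; rewrite leNgt; apply/negP => uv.
have [iv|vi] := leP (v + 1) i.
  by apply: nv; apply: cv; rewrite /between; lia.
by apply: nv; apply: cu; rewrite /between; lia.
Qed.

Lemma dmeas_cl_left i : dmeas (fun w => cl_left d (c w) i).
Proof.
apply: dmeas_xget => [w x y|x]; first exact: cl_left_uniq.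
by apply: mset_and; [exact: mset_cluster_of|exact/mset_not/mset_claimed].
Qed.

Lemma dmeas_cl_right i : dmeas (fun w => cl_right d (c w) i).
Proof.
apply: dmeas_xget => [w x y|x]; first exact: cl_right_uniq.
by apply: mset_and; [exact: mset_cluster_of|exact/mset_not/mset_claimed].
Qed.

Section FixedCluster.
Variables a b : int.

Lemma dmeas_hsC : dmeas (fun w => hsC d (c w) a b).
Proof. by apply: dmeas_filter => i; exact: dmeas_high. Qed.

Lemma dmeas_lowsC : dmeas (fun w => lowsC d (c w) a b).
Proof.
by apply: (dmeas_filter (fun i w => ~~ high d (c w) i)) => i; exact/(dmeas_comp negb)/dmeas_high.
Qed.

Lemma dmeas_pair_shift : dmeas (fun w => pair_shift d (c w) a b).
Proof.
apply: (dmeas_comp2 (fun (hs : seq int) (x : bool) => if odd (size hs) && ~~ x then 1 else 0)%N).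
  exact: dmeas_hsC.
exact: dmeas_coin.
Qed.

Lemma dmeas_pair_edges : dmeas (fun w => pair_edges d (c w) a b).
Proof.
apply: (dmeas_comp2 (fun hs s => [seq (nth 0 hs (s + 2 * t), nth 0 hs (s + 2 * t).+1)
     | t <- iota 0 (size hs)./2] : seq (int * int))).
  exact: dmeas_hsC.
exact: dmeas_pair_shift.
Qed.

Lemma dmeas_paired x : dmeas (fun w => paired d (c w) a b x).
Proof.
apply: (dmeas_comp2 (fun hs s => x \in [seq nth 0 hs (s + t) | t <- iota 0 (2 * (size hs)./2)])).
  exact: dmeas_hsC.
exact: dmeas_pair_shift.
Qed.

Lemma dmeas_bad_rest : dmeas (fun w => bad_rest d (c w) a b).
Proof.
apply: (dmeas_bind (fun w => hsC d (c w) a b) (fun hs w =>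
  flatten [seq nseq (Dd d (c w) x - paired d (c w) a b x)%N x | x <- hs])).
  exact: dmeas_hsC.
move=> hs; apply: (dmeas_comp flatten); apply: dmeas_map => x.
apply: (dmeas_comp2 (fun n (p : bool) => nseq (n - p) x)); first exact: dmeas_Dd.
exact: dmeas_paired.
Qed.

Lemma lab_le_total w : total (lab_le (c w)).
Proof. by move=> u v; rewrite /lab_le; case: (ltgtP (cL _ u)) => //= _; exact: le_total. Qed.

Lemma lab_le_trans w : transitive (lab_le (c w)).
Proof.
move=> v u x; rewrite /lab_le.
move=> /orP[uv|/andP[/eqP uv h]] /orP[vx|/andP[/eqP vx h']].
- by rewrite (lt_trans uv vx).
- by rewrite -vx uv.
- by rewrite uv vx.
- by rewrite uv vx eqxx (le_trans h h') orbT.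
Qed.

Lemma lab_le_anti w : antisymmetric (lab_le (c w)).
Proof.
move=> u v; rewrite /lab_le; case: (ltgtP (cL _ u) (cL _ v)) => //= _.
by move=> h; apply/eqP; rewrite eq_le.
Qed.

(** For a frozen list, the result is t exactly when t is a permutation of it and sorted for the
    random order. This uses antisymmetry, which the tie-break in [lab_le] provides. *)
Lemma dmeas_sort : dmeas (fun w => sort (lab_le (c w)) (lowsC d (c w) a b)).
Proof.
apply: (dmeas_bind (fun w => lowsC d (c w) a b) (fun s w => sort (lab_le (c w)) s)).
  exact: dmeas_lowsC.
move=> s t.
rewrite (_ : [set _ | _] = [set w | sorted (lab_le (c w)) t /\ perm_eq s t]).
  apply: mset_and; last exact: mset_Prop.
  apply: mset_bool; case: t => [|x t] /=; first exact: dmeas_cst.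
  elim: t x => [|y t IH] x /=; first exact: dmeas_cst.
  by apply: (dmeas_comp2 andb) => //; exact: dmeas_lab_le.
apply/seteqP; split => w /=.
  by move=> <-; split; [exact/sort_sorted/lab_le_total|rewrite perm_sym perm_sort].
move=> [st pst]; apply: (sorted_eq (@lab_le_trans w) (@lab_le_anti w)) => //.
  by apply: sort_sorted; exact: lab_le_total.
by rewrite perm_sort.
Qed.

Lemma dmeas_chosen : dmeas (fun w => chosen d (c w) a b).
Proof.
apply: (dmeas_comp2 (fun (r s : seq int) => take (size r) s)).
  exact: dmeas_bad_rest.
exact: dmeas_sort.
Qed.

Lemma dmeas_step1_edges : dmeas (fun w => step1_edges d (c w) a b).
Proof.
apply: (dmeas_comp2 cat); first exact: dmeas_pair_edges.
by apply: (dmeas_comp2 zip); [exact: dmeas_bad_rest|exact: dmeas_chosen].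
Qed.

End FixedCluster.

Lemma dmeas_claimed i : dmeas (fun w => `[< claimed d (c w) i >]).
Proof. exact/dmeas_asbool/mset_claimed. Qed.

Lemma dmeas_step1_len i : dmeas (fun w => step1_len d (c w) i).
Proof.
apply: dmeas_if; [exact: dmeas_claimed| |exact: dmeas_cst].
apply: (dmeas_bind (fun w => cl_left d (c w) i) (fun x w =>
  len_at i (step1_edges d (c w) x (cl_right d (c w) i)))); first exact: dmeas_cl_left.
move=> x; apply: (dmeas_bind (fun w => cl_right d (c w) i) (fun y w =>
  len_at i (step1_edges d (c w) x y))); first exact: dmeas_cl_right.
by move=> y; apply: (dmeas_comp (len_at i)); exact: dmeas_step1_edges.
Qed.

Section Kth.
Variable p : int -> T -> bool.
Hypothesis mp : forall i, dmeas (p i).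

Lemma dmeas_kth_right i k : dmeas (fun w => kth_right (p^~ w) i k).
Proof.
apply: dmeas_xget => [w x y|x]; first exact: is_kth_right_uniq.
apply: mset_and; first exact: mset_Prop.
apply: mset_and; first exact: mset_bool.
exact: dmeas_count.
Qed.

Lemma dmeas_kth_left i k : dmeas (fun w => kth_left (p^~ w) i k).
Proof.
apply: dmeas_xget => [w x y|x]; first exact: is_kth_left_uniq.
apply: mset_and; first exact: mset_Prop.
apply: mset_and; first exact: mset_bool.
exact: dmeas_count.
Qed.

End Kth.

Lemma dmeas_step2_len i : dmeas (fun w => step2_len d (c w) i).
Proof.
apply: dmeas_if; [exact: dmeas_high| |exact: dmeas_cst].
apply: dmeas_sum => k; apply: (dmeas_comp2 addn).
  apply: (dmeas_comp (fun v : int => `|v - i|%N)).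
  exact/(dmeas_kth_right (fun i w => high d (c w) i))/dmeas_high.
apply: (dmeas_comp (fun v : int => `|i - v|%N)).
exact/(dmeas_kth_left (fun i w => high d (c w) i))/dmeas_high.
Qed.

Lemma dmeas_chosen1 v : dmeas (fun w => chosen1 d (c w) v).
Proof.
apply: (dmeas_comp2 andb); first exact: dmeas_claimed.
apply: (dmeas_bind (fun w => cl_left d (c w) v) (fun x w =>
  v \in chosen d (c w) x (cl_right d (c w) v))); first exact: dmeas_cl_left.
move=> x; apply: (dmeas_bind (fun w => cl_right d (c w) v) (fun y w =>
  v \in chosen d (c w) x y)); first exact: dmeas_cl_right.
by move=> y; apply: (dmeas_comp (fun s : seq int => v \in s)); exact: dmeas_chosen.
Qed.

Lemma dmeas_Dp v : dmeas (fun w => Dp d (c w) v).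
Proof.
apply: dmeas_if; [exact: dmeas_high|exact: dmeas_cst|].
apply: (dmeas_comp2 (fun n (b : bool) => n - b)%N); first exact: dmeas_cD.
exact: dmeas_chosen1.
Qed.

Lemma dmeas_Gam j v : dmeas (fun w => Gam d (c w) j v).
Proof. exact/(dmeas_comp (leq j))/dmeas_Dp. Qed.

Lemma first_nonneg_uniq (g : int -> bool) (x y : int) :
  0 <= x /\ g x /\ (forall u, 0 <= u < x -> ~~ g u) ->
  0 <= y /\ g y /\ (forall u, 0 <= u < y -> ~~ g u) -> x = y.
Proof.
move=> [x0 [gx hx]] [y0 [gy hy]]; case: (ltgtP x y) => // h.
  by have := hy x; rewrite gx x0 h => /(_ isT).
by have := hx y; rewrite gy y0 h => /(_ isT).
Qed.

Lemma dmeas_first_nonneg j : dmeas (fun w => first_nonneg d (c w) j).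
Proof.
apply: dmeas_xget => [w|x]; first exact: first_nonneg_uniq.
apply: mset_and; first exact: mset_Prop.
apply: mset_and; first exact/mset_bool/dmeas_Gam.
apply: mset_all => u; apply: mset_imply => _.
by apply: mset_bool; apply: (dmeas_comp negb); exact: dmeas_Gam.
Qed.

Lemma dmeas_dir_right j i : dmeas (fun w => dir_right d (c w) j i).
Proof.
apply: (dmeas_comp2 addb); first exact: dmeas_coin.
apply: (dmeas_comp odd).
apply: (dmeas_bind (fun w => first_nonneg d (c w) j) (fun f w =>
  if f <= i then count (Gam d (c w) j) (take `|i - f|%N (iseg f i))
           else count (Gam d (c w) j) (take `|f - i|%N (iseg i f)))).
  exact: dmeas_first_nonneg.
move=> f; apply: dmeas_if; first exact: dmeas_cst.
  by apply: (dmeas_count (fun v w => Gam d (c w) j v)) => v; exact: dmeas_Gam.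
by apply: (dmeas_count (fun v w => Gam d (c w) j v)) => v; exact: dmeas_Gam.
Qed.

Lemma dmeas_len3 j i : dmeas (fun w => len3 d (c w) j i).
Proof.
apply: dmeas_if; first exact: dmeas_dir_right.
  apply: (dmeas_comp (fun v : int => `|v - i|%N)).
  exact/(dmeas_kth_right (fun i w => Gam d (c w) j i))/dmeas_Gam.
apply: (dmeas_comp (fun v : int => `|i - v|%N)).
exact/(dmeas_kth_left (fun i w => Gam d (c w) j i))/dmeas_Gam.
Qed.

Lemma dmeas_step3_len i : dmeas (fun w => step3_len d (c w) i).
Proof.
apply: (dmeas_bind (fun w => Dp d (c w) i) (fun n w =>
  \sum_(1 <= j < n.+1) len3 d (c w) j i)%N); first exact: dmeas_Dp.
by move=> n; apply: dmeas_sum => j; exact: dmeas_len3.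
Qed.

Lemma dmeas_total_len i : dmeas (fun w => total_len d (c w) i).
Proof.
apply: (dmeas_comp2 addn); last exact: dmeas_step3_len.
by apply: (dmeas_comp2 addn); [exact: dmeas_step1_len|exact: dmeas_step2_len].
Qed.

End ModelMeasurability.

(** * Edges of the first step *)

Lemma claimedb_opp a v : claimedb (fun u => a (- u)) v = claimedb a (- v).
Proof.
suff e m : wsum (fun u => a (- u)) v m = wsum a (- v) m.
  by apply/asboolP/asboolP => -[m [m0 hm]]; exists m; rewrite ?e// -e.
rewrite /wsum (reindex_inj rev_ord_inj) /=; apply: eq_bigr => t _.
by congr a; have := ltn_ord t; lia.
Qed.

Lemma reach_opp a N : reach (fun u => a (- u)) N = reach a N.
Proof.
rewrite /reach oppr0.
rewrite (@eq_mkseq _ (fun k : nat => a (- (1 + k%:Z))) (fun k => a (-1 - k%:Z))); last first.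
  by move=> k; congr a; lia.
rewrite (@eq_mkseq _ (fun k : nat => a (- (-1 - k%:Z))) (fun k => a (1 + k%:Z))); last first.
  by move=> k; congr a; lia.
by rewrite addnC addnA addnAC.
Qed.

Lemma count_le1 (I : eqType) (q : pred I) (s : seq I) : uniq s ->
  {in s &, forall x y, q x -> q y -> x = y} -> (count q s <= 1)%N.
Proof.
move=> us hq; rewrite -size_filter.
have : {in [seq x <- s | q x] &, forall x y, x = y}.
  by move=> x y; rewrite !mem_filter => /andP[qx xs] /andP[qy ys]; exact: hq.
have := filter_uniq q us.
case: [seq x <- s | q x] => [|x [|y l]] //= /andP[+ _] /(_ x y).
by rewrite !inE !eqxx orbT => + /(_ isT isT) e; rewrite e eqxx.
Qed.

Lemma count_unzip1_zip (I J : Type) (q : pred I) (s : seq I) (t : seq J) :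
  (count (fun e => q e.1) (zip s t) <= count q s)%N.
Proof. by elim: s t => [|x s IH] [|y t] //=; rewrite leq_add2l. Qed.

Lemma count_unzip2_zip (I J : Type) (q : pred J) (s : seq I) (t : seq J) :
  (count (fun e => q e.2) (zip s t) <= count q t)%N.
Proof. by elim: s t => [|x s IH] [|y t] //=; rewrite leq_add2l. Qed.

Lemma count_flatten_nseq (I : eqType) (n : I -> nat) (s : seq I) x : uniq s ->
  (count_mem x (flatten [seq nseq (n y) y | y <- s]) <= n x)%N.
Proof.
move=> us; have -> : count_mem x (flatten [seq nseq (n y) y | y <- s]) = (n x * count_mem x s)%N.
  elim: s {us} => [|y s IH] /=; first by rewrite muln0.
  rewrite count_cat IH count_nseq mulnDr /=; congr (_ + _)%N.
  by case: eqP => [->|_]; rewrite ?mul1n ?muln1 ?mul0n ?muln0.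
by rewrite count_uniq_mem//; case: (_ \in _); rewrite ?muln1 ?muln0.
Qed.

Lemma len_at_le i (E : seq (int * int)) (L C : nat) :
  {in E, forall e, (`|(e.1 - e.2)%R| <= L)%N} ->
  (count (fun e => (e.1 == i) || (e.2 == i)) E <= C)%N -> (len_at i E <= C * L)%N.
Proof.
move=> hL hC; apply: (@leq_trans (count (fun e => (e.1 == i) || (e.2 == i)) E * L)); last first.
  by rewrite leq_mul2r hC orbT.
elim: E hL {hC} => [|e E IH] hL //; rewrite /len_at /=.
have {}IH : (len_at i E <= count (fun e => (e.1 == i) || (e.2 == i)) E * L)%N.
  by apply: IH => x xE; apply: hL; rewrite inE xE orbT.
case: ifP => _ /=; last by rewrite add0n.
by rewrite mulnDl mul1n leq_add// hL// mem_head.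
Qed.

Section StepOne.
Context {R : realType} (d : nat) (c : config R).

Lemma iseg_uniq a b : uniq (iseg a b).
Proof. by rewrite map_inj_uniq ?iota_uniq// => x y; lia. Qed.

Lemma mem_iseg a b x : a <= b -> x \in iseg a b -> a <= x <= b.
Proof. by move=> ab /mapP[t]; rewrite mem_iota => ht ->; lia. Qed.

(** Keeps every index of [pair_edges] in range; otherwise the default 0 of [nth] would create
    spurious edges at the origin. *)
Lemma pair_shift_le a b : (pair_shift d c a b + 2 * (size (hsC d c a b))./2 <= size (hsC d c a b))%N.
Proof.
rewrite /pair_shift; case: ifP => [/andP[h _]|_]; have := odd_double_half (size (hsC d c a b)).
  by rewrite h; lia.
by lia.
Qed.

Lemma nth_hsC_inj a b (k k' : nat) : (k < size (hsC d c a b))%N -> (k' < size (hsC d c a b))%N ->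
  nth 0 (hsC d c a b) k = nth 0 (hsC d c a b) k' -> k = k'.
Proof.
move=> hk hk' /eqP; rewrite nth_uniq//; first by move/eqP.
by apply: filter_uniq; exact: iseg_uniq.
Qed.

(** The 3 is one occurrence of 0 in each coordinate of the pairing edges, and one as a chosen low
    vertex. *)
Lemma count_step1_edges a b :
  (count (fun e => (e.1 == 0%R) || (e.2 == 0%R)) (step1_edges d c a b) <= Dd d c 0%R + 3)%N.
Proof.
have hor (E : seq (int * int)) : (count (fun e => (e.1 == 0%R) || (e.2 == 0%R)) E <=
    count (fun e => e.1 == 0%R) E + count (fun e => e.2 == 0%R) E)%N.
  by rewrite -count_predUI leq_addr.
have hs := pair_shift_le a b.
have us : uniq (hsC d c a b) by apply: filter_uniq; exact: iseg_uniq.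
have h1 : (count (fun e => e.1 == 0%R) (pair_edges d c a b) <= 1)%N.
  rewrite count_map; apply: count_le1 => [|t t']; first exact: iota_uniq.
  rewrite !mem_iota /= => ht ht' /eqP e /eqP e'.
  have := nth_hsC_inj a b _ _ _ _ (etrans e (esym e')); lia.
have h2 : (count (fun e => e.2 == 0%R) (pair_edges d c a b) <= 1)%N.
  rewrite count_map; apply: count_le1 => [|t t']; first exact: iota_uniq.
  rewrite !mem_iota /= => ht ht' /eqP e /eqP e'.
  have := nth_hsC_inj a b _ _ _ _ (etrans e (esym e')); lia.
have h3 : (count (fun e => e.1 == 0%R) (zip (bad_rest d c a b) (chosen d c a b)) <= Dd d c 0%R)%N.
  apply: leq_trans (count_unzip1_zip _ _ (pred1 0%R) _ _) _.
  apply: leq_trans (count_flatten_nseq _ (fun x => Dd d c x - paired d c a b x)%N _ _ us) _.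
  exact: leq_subr.
have h4 : (count (fun e => e.2 == 0%R) (zip (bad_rest d c a b) (chosen d c a b)) <= 1)%N.
  apply: leq_trans (count_unzip2_zip _ _ (pred1 0%R) _ _) _.
  rewrite count_uniq_mem ?leq_b1// take_uniq// sort_uniq.
  by apply: filter_uniq; exact: iseg_uniq.
rewrite /step1_edges count_cat.
have := hor (pair_edges d c a b); have := hor (zip (bad_rest d c a b) (chosen d c a b)).
lia.
Qed.

Lemma step1_edges_len a b : a <= 0 -> 0 <= b ->
  {in step1_edges d c a b, forall e, (`|(e.1 - e.2)%R| <= `|b|%N + `|a|%N)%N}.
Proof.
move=> a0 b0 [x y]; rewrite mem_cat => h.
suff [hx hy] : a <= x <= b /\ a <= y <= b by rewrite /=; lia.
have ab : a <= b by exact: le_trans b0.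
have hhs u : u \in hsC d c a b -> a <= u <= b.
  by rewrite mem_filter => /andP[_]; exact: mem_iseg.
have hnth k : a <= nth 0 (hsC d c a b) k <= b.
  have [h'|h'] := ltnP k (size (hsC d c a b)); first exact/hhs/mem_nth.
  by rewrite nth_default// a0.
case/orP: h => [/mapP[t _ [-> ->]]|h]; first by split.
have hz (s t : seq int) : (x, y) \in zip s t -> x \in s /\ y \in t.
  elim: s t => [|u s IH] [|v t] //=; rewrite !inE => /predU1P[[-> ->]|/IH[-> ->]];
  by rewrite ?eqxx ?orbT.
have [/flattenP[l /mapP[u uh ->]] /nseqP[-> _]] := hz _ _ h.
move=> /mem_take; rewrite mem_sort mem_filter => /andP[_ /(mem_iseg _ _ _ ab) hy].
by split=> //; exact: hhs.
Qed.

Lemma between_r (x j : int) : 0 <= j -> j <= x -> between 0 x j.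
Proof. by rewrite /between; lia. Qed.

Lemma between_l (x j : int) : x <= j -> j <= 0 -> between 0 x j.
Proof. by rewrite /between; lia. Qed.

(** Without a left end the default is 0 and the range is empty, so finiteness of the cluster need
    not be known here. *)
Lemma cl_left_le0 : cl_left d c 0 <= 0 /\
  forall v, cl_left d c 0 <= v < 0 -> claimed d c v.
Proof.
rewrite /cl_left; case: xgetP => [x _ [hx nx]|_]; last by split=> // v; lia.
have x0 : x <= 0.
  by rewrite leNgt; apply/negP => x0; apply: nx; apply/hx/between_r; lia.
by split=> // v /andP[xv v0]; apply/hx/between_l => //; exact: ltW.
Qed.

Lemma cl_right_ge0 : 0 <= cl_right d c 0 /\
  forall v, 0 < v <= cl_right d c 0 -> claimed d c v.
Proof.
rewrite /cl_right; case: xgetP => [x _ [hx nx]|_]; last by split=> // v; lia.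
have x0 : 0 <= x.
  by rewrite leNgt; apply/negP => x0; apply: nx; apply/hx/between_l; lia.
by split=> // v /andP[v0 vx]; apply/hx/between_r => //; exact: ltW.
Qed.

Let a v := Dd d c v.

Lemma nclaimed_all (f : int -> nat) n : (forall k, (k < n)%N -> claimedb f (1 + k%:Z)) ->
  nclaimed f n = n.
Proof.
move=> h; rewrite /nclaimed -[RHS]card_ord -sum1_card; apply: eq_bigr => k _.
by rewrite h.
Qed.

(** With l and r the cluster endpoints, all of 1..r is claimed, so [half_claimed_reach] bounds r,
    and by reflection |l|. At most a_0 + 3 edges at 0 have length at most |l| + |r|. *)
Lemma step1_len_reach : exists N, (step1_len d c 0 <= (a 0%R + 3) * (2 * reach a N))%N.
Proof.
rewrite /step1_len; case: ifP => _; last by exists 0%N.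
have [l0 hl] := cl_left_le0; have [r0 hr] := cl_right_ge0.
set l := cl_left d c 0 in l0 hl *; set r := cl_right d c 0 in r0 hr *.
have [N1 h1] : exists N, (`|r|%N <= reach a N)%N.
  apply: half_claimed_reach; rewrite nclaimed_all ?leq_pmull// => k kr.
  by apply/asboolP; apply: hr; lia.
have [N2 h2] : exists N, (`|l|%N <= reach a N)%N.
  have [|N] := half_claimed_reach (fun v => a (- v)) `|l|%N; last by rewrite reach_opp; exists N.
  rewrite nclaimed_all ?leq_pmull// => k kl; rewrite claimedb_opp.
  by apply/asboolP; apply: hl; lia.
exists (maxn N1 N2); apply: len_at_le; last exact: count_step1_edges.
move=> e he; apply: leq_trans (step1_edges_len _ _ l0 r0 e he) _.
have := reach_mono a _ _ (leq_maxl N1 N2); have := reach_mono a _ _ (leq_maxr N1 N2).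
lia.
Qed.

End StepOne.

(** * Expected lengths *)

Lemma unclaimed0 a v : ~~ claimedb a v -> a v = 0%N.
Proof.
move=> h; apply: (claimed_upto0 a 1) => //; apply: contra h.
by move=> /existsP[m /andP[m0 hm]]; apply/asboolP; exists m.
Qed.

(** An unclaimed vertex is low and is never chosen in Step 1, so all its stubs remain. *)
Lemma unclaimed_Gam (R : realType) d (c : config R) j v :
  ~~ claimedb (Dd d c) v -> (j <= cD c v)%N -> Gam d c j v.
Proof.
move=> h jD; have := unclaimed0 _ _ h; rewrite /Dd => h0.
rewrite /Gam /Dp /high ltnNge (_ : (cD c v <= d)%N)//=; last by rewrite -subn_eq0 h0.
rewrite /chosen1 (_ : `[< claimed d c v >] = false) ?subn0//.
exact: (negbTE h).
Qed.

Section Finiteness.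
Context {R : realType} {dm : measure_display} {T : measurableType dm}.
Variable P : probability T R.

(** The common scheme of Steps 2 and 3: a distance beyond n forces a small count on n vertices, and
    these probabilities are summable. *)
Lemma expect_far_lty (f : T -> nat) (q : nat -> T -> nat) (K : nat) (C : R) :
  dmeas f -> (forall n, dmeas (q n)) ->
  (forall n w, (n < f w)%N -> (q n w < K)%N) ->
  (forall M, \sum_(n < M) P [set w | (q n w < K)%N] <= C%:E)%E ->
  (expect P f < +oo)%E.
Proof.
move=> mf mq fq hC; apply: le_lt_trans (ltry C).
apply: expect_tail_bound => // M; apply: le_trans (hC M).
apply: lee_sum => n _; apply: le_measure; rewrite ?inE.
- exact: (mset_pred f (fun x => (n < x)%N)).
- exact: (mset_pred (q n) (fun x => (x < K)%N)).
- by move=> w; exact: fq.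
Qed.

(** Handles degenerate laws, where the vertices awaited are almost surely absent and so is the
    corresponding stub at 0. *)
Lemma expect_null_lty (f : T -> nat) (b : T -> bool) :
  dmeas f -> dmeas b -> (forall w, (0 < f w)%N -> b w) ->
  P [set w | b w] = 0%E -> (expect P f < +oo)%E.
Proof.
move=> mf mb fb Pb; apply: (@expect_far_lty f (fun _ w => (~~ b w : nat)) 1 0) => //.
- by move=> _; exact: (dmeas_comp (fun b : bool => (~~ b : nat))).
- by move=> n w nf; rewrite ltnS leqn0 eqb0 negbK fb// (leq_ltn_trans _ nf).
move=> M; rewrite big1// => n _; rewrite -Pb; congr (P _).
by apply/seteqP; split => w /=; case: (b w).
Qed.

Lemma le_expect_lty (f g : T -> nat) : dmeas f -> dmeas g ->
  (forall w, f w <= g w)%N -> (expect P g < +oo)%E -> (expect P f < +oo)%E.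
Proof. by move=> mf mg fg; apply: le_lt_trans; exact: le_expect. Qed.

Section Family.
Variable F : nat -> R.
Hypothesis F_ge0 : forall n, 0 <= F n.
Hypothesis F_sum1 : (\sum_(0 <= n <oo) (F n)%:E = 1)%E.
Variable d : nat.
Variable m2 : R.
Hypothesis mean_sq : (mean F (fun k => (32 * (k - d))%:R ^+ 2)%R <= m2%:E)%E.
Hypothesis mean_small : (mean F (fun k => (32 * (k - d))%:R)%R <= (2^-1)%:E)%E.

Lemma prob_one_null (D : int -> T -> nat) (q : nat -> bool) : iid P F D ->
  (forall k, q k -> F k = 0) -> P [set w | q (D 0 w)] = 0%E.
Proof.
move=> hD hq; rewrite -expect_bool; last by apply: (dmeas_comp q); case: hD.
rewrite (expect_one P F F_ge0 D hD (fun k => q k : nat)).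
rewrite /mean eseries0// => k _ _; case: (boolP (q k)) => [/hq ->|_].
  by rewrite mul0r.
by rewrite mulr0.
Qed.

(** If all vertices from n on are claimed, then half of 1..m is claimed for every m >= 2n; a fixed
    positive probability would make the sum of [sum_half_claimed] diverge. *)
Lemma all_claimed_null (D : int -> T -> nat) n : iid P F D ->
  P [set w | forall k : nat, claimedb (excess d D w) (n%:Z + k%:Z)] = 0%E.
Proof.
move=> hD; set Z := [set w | _].
have mZ : measurable Z.
  by apply: mset_all => k; exact/mset_bool/(dmeas_claimedb P F).
have mH m : measurable [set w | half_claimed D d m w].
  exact/mset_bool/(dmeas_half_claimed P F).
have hZ m : (2 * n <= m)%N -> (P Z <= P [set w | half_claimed D d m w])%E.
  move=> nm; apply: le_measure; rewrite ?inE// => w hw.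
  change (m <= 2 * nclaimed (excess d D w) m)%N.
  have h : (\sum_(k < m) (n <= k)%N <= nclaimed (excess d D w) m)%N.
    apply: leq_sum => k _; case: (leqP n k) => // nk.
    have := hw (1 + (k - n))%N; rewrite (_ : n%:Z + _ = 1 + k%:Z); last by lia.
    by move=> ->.
  suff : (m - n <= \sum_(k < m) (n <= k)%N)%N by move: h; set x := bigop.body _ _ _; set y := nclaimed _ _; lia.
  elim: (m) => [|m' IH]; first by rewrite big_ord0.
  by move: IH; rewrite big_ord_recr /=; set x := bigop.body _ _ _; case: leqP; lia.
have hM M : (\sum_(i < M) P Z <= (2 * m2 + 4)%:E)%E.
  apply: le_trans (sum_half_claimed P F F_ge0 F_sum1 D hD d m2 mean_sq mean_small (2 * n + M)).
  rewrite big_split_ord /= -[leLHS]add0e leeD//; first exact: sume_ge0.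
  by apply: lee_sum => i _; apply: hZ; rewrite leq_addr.
have : P Z \is a fin_num by rewrite fin_num_measure.
have : (0 <= P Z)%E by [].
move: hM; case: (P Z) => [r| |]// hM; rewrite lee_fin => r0 _.
congr EFin; apply/eqP; rewrite eq_le r0 andbT leNgt; apply/negP => rp.
have [M hMr] : exists M : nat, (2 * m2 + 4) / r < M%:R.
  by exists (Num.truncn ((2 * m2 + 4) / r)).+1; exact: truncnS_gt.
have := hM M; rewrite sumEFin lee_fin sumr_const card_ord leNgt => /negP; apply.
by rewrite -[ltRHS]mulr_natl -ltr_pdivrMr.
Qed.

Lemma halve_mean : (exists2 k0, (d < k0)%N & 0 < F k0) ->
  exists rho, [/\ 0 <= rho, rho < 1 & mean F (halve (fun x => (d < x)%N)) = rho%:E].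
Proof.
move=> [k0 dk0 Fk0].
pose g x : R := 1 - halve (fun x => (d < x)%N) x.
have h0 x : 0 <= halve (R := R) (fun x => (d < x)%N) x by rewrite /halve; case: ifP.
have g0 x : 0 <= g x by rewrite /g /halve; case: ifP => _; lra.
have : (mean F (halve (fun x => (d < x)%N)) + mean F g = 1)%E.
  rewrite -meanD// -[RHS](mean_cst F F_ge0 F_sum1 1)//.
  by apply: eq_eseriesr => k _; rewrite /g addrC subrK.
have gk0 : ((F k0 / 2)%:E <= mean F g)%E.
  apply: le_trans (nneseries_lim_ge k0.+1 _); last first.
    by move=> k _ _; rewrite lee_fin mulr_ge0.
  rewrite big_nat_recr//= -[leLHS]add0e leeD//; first by apply: sume_ge0 => k _; rewrite lee_fin mulr_ge0.
  by rewrite lee_fin /g /halve dk0; lra.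
have := mean_ge0 F F_ge0 _ h0.
move: gk0; case: (mean F g) => [y| |]//; case: (mean F _) => [x| |]//.
rewrite !lee_fin => yk x0 [xy]; exists x; split=> //.
by have := divr_gt0 Fk0 (ltr0n R 2); lra.
Qed.

(** [rho] is the mean of [halve] given degree at most [d]; the atom k0 makes the given event
    possible and the mean strictly less than 1. *)
Lemma halve_sum j : (exists2 k0, (j <= k0 <= d)%N & 0 < F k0) ->
  exists rho : R, [/\ 0 < rho, rho < 1 &
    \sum_(0 <= k < d.+1) F k * halve (leq j) k = rho * \sum_(0 <= k < d.+1) F k].
Proof.
move=> [k0 /andP[jk0 k0d] Fk0].
have term_le (g : nat -> R) : (forall k, 0 <= g k) -> g k0 <= \sum_(0 <= k < d.+1) g k.
  move=> g0; rewrite (bigD1_seq k0) ?iota_uniq//=; last by rewrite mem_index_iota.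
  by rewrite lerDl sumr_ge0.
pose A := \sum_(0 <= k < d.+1) F k * halve (leq j) k; pose B := \sum_(0 <= k < d.+1) F k.
have B0 : 0 < B by apply: lt_le_trans (term_le F F_ge0).
have A0 : 0 < A.
  apply: lt_le_trans (term_le (fun k => F k * halve (leq j) k) _).
    by rewrite /halve jk0 mulr_gt0.
  by move=> k; rewrite mulr_ge0// /halve; case: ifP.
have AB : A < B.
  rewrite -subr_gt0 /A /B -sumrB.
  apply: lt_le_trans (term_le (fun k => F k - F k * halve (leq j) k) _).
    by rewrite /halve jk0; lra.
  by move=> k; rewrite /halve; case: ifP => _; have := F_ge0 k; lra.
exists (A / B); split; first exact: divr_gt0.
  by rewrite ltr_pdivrMr// mul1r.
by rewrite -/A -/B divfK// gt_eqF.
Qed.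

Section Model.
Hypothesis F0 : F 0%N = 0.
Variable U : Src -> T -> R.
Hypothesis U_unif : forall s, uniform01_rv P (U s).
Hypothesis U_ind : mutually_independent P U.

Let c w := cfg_of F U w.
Let D i w := quantile F (U (SDeg i) w).

Let U_meas s : measurable_fun setT (U s). Proof. by case: (U_unif s). Qed.

Let D_iid : iid P F D. Proof. exact: iid_quantile. Qed.

Let D'_iid : iid P F (fun i => D (- i)). Proof. exact: iid_opp. Qed.

(** A cluster is confined between unclaimed vertices on its two sides, so an infinite one contains a
    half-line; there are countably many of these, each null. *)
Lemma clusters_finite_ae : {ae P, forall w, clusters_finite d (c w)}.
Proof.
pose Z (D : int -> T -> nat) n := [set w | forall k : nat, claimedb (excess d D w) (n%:Z + k%:Z)].
suff neg : P.-negligible (\bigcup_n (Z D n `|` Z (fun i => D (- i)) n)).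
  apply: negligibleS neg => w /= /existsNP[i /not_implyP[ci fi]].
  have [hr|/existsNP[k hk]] := pselect (forall k : nat, claimed d (c w) (i + k%:Z)).
    (* The half-line from i contains the one from |i|, which has a natural starting point. *)
    exists `|i|%N => //; left => k; apply/asboolP.
    have := hr (absz ((absz i)%:Z - i + k%:Z)%R).
    by rewrite (_ : i + _ = (absz i)%:Z + k%:Z)//; lia.
  have [hl|/existsNP[k' hk']] := pselect (forall k : nat, claimed d (c w) (i - k%:Z)).
    exists `|i|%N => //; right => n.
    rewrite (claimedb_opp (excess d D w)); apply/asboolP.
    have := hl (absz ((absz i)%:Z + i + n%:Z)%R).
    by rewrite (_ : i - _ = - ((absz i)%:Z + n%:Z))//; lia.
  exfalso; apply: fi; apply: (@sub_finite_set _ _ [set` iseg (i - k'%:Z) (i + k%:Z)]).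
    move=> v hv /=; apply/mapP; exists (absz (v - (i - k'%:Z))%R); last first.
      have : ~ (v < i - k'%:Z) by move=> h; apply: hk'; apply: hv; rewrite /between; lia.
      lia.
    have h1 : ~ (v < i - k'%:Z) by move=> h; apply: hk'; apply: hv; rewrite /between; lia.
    have h2 : ~ (i + k%:Z < v) by move=> h; apply: hk; apply: hv; rewrite /between; lia.
    rewrite mem_iota; lia.
  exact: finite_seq.
apply: negligible_bigcup => n; apply: negligibleU.
  apply/negligibleP; last exact: all_claimed_null.
  by apply: mset_all => k; exact/mset_bool/(dmeas_claimedb P F).
apply/negligibleP; last exact: all_claimed_null.
by apply: mset_all => k; exact/mset_bool/(dmeas_claimedb P F).
Qed.

Lemma expect_step1_lty : (expect P (fun w => step1_len d (c w) 0) < +oo)%E.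
Proof.
pose r N w := reach (excess d D w) N.
have mr N : dmeas (r N) by exact: (dmeas_reach P F).
have mra N : dmeas (fun w => 32 * excess d D w 0%R * r N w)%N.
  apply: (dmeas_comp2 (fun x y => 32 * (x - d) * y)%N) => //.
  by case: D_iid.
(* Dominates (a_0 + 3) * 2 r, with the factor 32 kept for [expect_excess_reach]. *)
pose f N w := (2 * (32 * excess d D w 0%R * r N w) + 6 * r N w)%N.
apply: (le_lt_trans _ (ltry (2 * (2^-1 * (m2 + 1) + m2 + 2^-1 * (m2 + 1)) +
   6 * (m2 + 1 + 2^-1 + (m2 + 1))))).
apply: (expect_monotone_bound P _ f).
- exact: dmeas_step1_len.
- move=> N; apply: (dmeas_comp2 addn); first exact: (dmeas_comp (muln 2)).
  exact: (dmeas_comp (muln 6)).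
- move=> w n m nm; have := reach_mono (excess d D w) _ _ nm; rewrite /f /r.
  by move=> h; rewrite leq_add// leq_mul// leq_mul.
- move=> w; have [N hN] := step1_len_reach d (c w); exists N.
  apply: leq_trans hN _.
  change ((excess d D w 0%R + 3) * (2 * reach (excess d D w) N) <= f N w)%N.
  by rewrite /f /r; move: (excess d D w 0%R) (reach _ N) => y x; nia.
move=> N; rewrite expectD; last 2 first.
- exact: (dmeas_comp (muln 2)).
- exact: (dmeas_comp (muln 6)).
rewrite !expectZ// [leRHS]EFinD leeD//.
  rewrite [leRHS]EFinM lee_wpmul2l//; exact: expect_excess_reach.
rewrite [leRHS]EFinM lee_wpmul2l//; exact: expect_reach.
Qed.

Lemma expect_step2_lty : (expect P (fun w => step2_len d (c w) 0) < +oo)%E.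
Proof.
have mh i : dmeas (fun w => high d (c w) i) by exact: dmeas_high.
(* If [F] has no mass above [d], vertex 0 is almost surely low and has no Step 2 edges. *)
have [/halve_mean[rho [r0 r1 hr]]|nh] := pselect (exists2 k0, (d < k0)%N & 0 < F k0); last first.
  apply: (expect_null_lty _ (fun w => high d (c w) 0)) => //.
  - exact: dmeas_step2_len.
  - by move=> w; rewrite /step2_len; case: ifP.
  apply: (prob_one_null D (fun k => (d < k)%N)) => // k dk; apply/eqP.
  by rewrite eq_le F_ge0 andbT leNgt; apply/negP => Fk; apply: nh; exists k.
have mkr k : dmeas (fun w => `|kth_right (high d (c w)) 0 k|%N).
  apply: (dmeas_comp (fun v : int => `|v|%N)).
  exact/(dmeas_kth_right (fun i w => high d (c w) i)).
have mkl k : dmeas (fun w => `|kth_left (high d (c w)) 0 k|%N).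
  apply: (dmeas_comp (fun v : int => `|v|%N)).
  exact/(dmeas_kth_left (fun i w => high d (c w) i)).
pose g k w := (`|kth_right (high d (c w)) 0%R k| + `|kth_left (high d (c w)) 0%R k|)%N.
have mg k : dmeas (g k) by exact: (dmeas_comp2 addn).
apply: (le_expect_lty _ (fun w => \sum_(k <- iota 2 d./2) g k w)%N).
- exact: dmeas_step2_len.
- exact: dmeas_sum.
- move=> w; rewrite /step2_len; case: ifP => // _.
  rewrite /index_iota (_ : (d./2).+2 - 2 = d./2)%N; last by lia.
  by apply: leq_sum => k _; rewrite subr0 sub0r abszN.
rewrite expect_sum// big_seq; apply: lte_sum_pinfty => k; rewrite mem_iota => hk.
have k0 : (0 < k)%N by lia.
rewrite expectD//; apply: lte_add_pinfty.
  apply: (expect_far_lty _ (fun n w => \sum_(t < n) (d < D (1 + t%:Z)%R w)) k)%N => //.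
  - move=> n; apply: dmeas_sum => t; apply: (dmeas_comp (fun x => (d < x)%N : nat)).
    by case: D_iid.
  - by move=> n w; exact: kth_right_far.
  - by move=> M; exact: (sum_high_count _ _ _ _ D_iid _ _ _ _ _ _ hr).
apply: (expect_far_lty _ (fun n w => \sum_(t < n) (d < D (- (1 + t%:Z))%R w)) k)%N => //.
- move=> n; apply: dmeas_sum => t; apply: (dmeas_comp (fun x => (d < x)%N : nat)).
  by case: D_iid.
- by move=> n w; exact: kth_left_far.
- by move=> M; exact: (sum_high_count _ _ _ _ D'_iid _ _ _ _ _ _ hr).
Qed.

(** A low vertex has at most [d] stubs, so the random number of levels becomes the fixed range 1..d
    with an indicator. *)
Lemma step3_len_le w :
  (step3_len d (c w) 0 <= \sum_(j <- iota 1 d) Gam d (c w) j 0 * len3 d (c w) j 0)%N.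
Proof.
have Dpd : (Dp d (c w) 0 <= d)%N.
  by rewrite /Dp /high; case: ltnP => // h; apply: leq_trans (leq_subr _ _) h.
rewrite /step3_len /index_iota subn1 /=.
have -> : iota 1 d = iota 1 (Dp d (c w) 0) ++ iota (1 + Dp d (c w) 0) (d - Dp d (c w) 0).
  by rewrite -iotaD subnKC.
rewrite big_cat /=.
apply: leq_trans (leq_addr _ _).
rewrite !big_seq; apply: leq_sum => j; rewrite mem_iota => hj.
by rewrite /Gam (_ : (j <= _)%N) ?mul1n//; lia.
Qed.

Lemma expect_step3_lty : (expect P (fun w => step3_len d (c w) 0) < +oo)%E.
Proof.
have mG j v : dmeas (fun w => Gam d (c w) j v) by exact: dmeas_Gam.
have ml j : dmeas (fun w => len3 d (c w) j 0) by exact: dmeas_len3.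
have mGl j : dmeas (fun w => Gam d (c w) j 0%R * len3 d (c w) j 0%R)%N.
  by apply: (dmeas_comp2 (fun (b : bool) x => b * x)%N).
apply: (le_expect_lty _ _ _ _ step3_len_le).
- exact: dmeas_step3_len.
- exact: dmeas_sum.
rewrite expect_sum// big_seq; apply: lte_sum_pinfty => j; rewrite mem_iota => hj.
(* Without mass on j..d, level j is almost surely empty at 0, because a remaining stub at level j
   requires a low vertex of degree at least j. *)
have [/halve_sum[rho [r0 r1 hr]]|nh] := pselect (exists2 k0, (j <= k0 <= d)%N & 0 < F k0); last first.
  apply: (expect_null_lty _ (fun w => (j <= D 0 w <= d)%N)) => //.
  - by apply: (dmeas_comp (fun x => (j <= x <= d)%N)); case: D_iid.
  - move=> w; case hG : (Gam d (c w) j 0) => // _; move: hG.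
    rewrite /Gam /Dp /high; case: ltnP => [_|Dd']; first by lia.
    by move=> h; apply/andP; split => //; apply: leq_trans h (leq_subr _ _).
  apply: (prob_one_null D (fun k => (j <= k <= d)%N)) => // k dk; apply/eqP.
  by rewrite eq_le F_ge0 andbT leNgt; apply/negP => Fk; apply: nh; exists k.
have K0 : (0 < (2 * j).-1)%N by lia.
have mkr : dmeas (fun w => `|kth_right (Gam d (c w) j) 0 (2 * j).-1|%N).
  apply: (dmeas_comp (fun v : int => `|v|%N)).
  exact/(dmeas_kth_right (fun i w => Gam d (c w) j i)).
have mkl : dmeas (fun w => `|kth_left (Gam d (c w) j) 0 (2 * j).-1|%N).
  apply: (dmeas_comp (fun v : int => `|v|%N)).
  exact/(dmeas_kth_left (fun i w => Gam d (c w) j i)).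
(* The sum over both directions removes the dependence on the alternating direction rule and its
   coin. *)
apply: (le_expect_lty _ (fun w => `|kth_right (Gam d (c w) j) 0%R (2 * j).-1| +
    `|kth_left (Gam d (c w) j) 0%R (2 * j).-1|)%N) => //.
- exact: (dmeas_comp2 addn).
- move=> w; apply: (@leq_trans (len3 d (c w) j 0)); first by case: Gam; rewrite ?mul1n.
  rewrite /len3 subr0 sub0r abszN; case: ifP => _; [exact: leq_addr|exact: leq_addl].
rewrite expectD//; apply: lte_add_pinfty.
  apply: (expect_far_lty _ (fun n w => unclaimed_count D d j n w) (2 * j).-1) => //.
  - by move=> n; exact: (dmeas_unclaimed_count P F).
  - move=> n w /(kth_right_far _ _ _ K0); apply: leq_ltn_trans.
    apply: leq_sum => k _; case: (boolP (_ && _)) => // /andP[h1 h2].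
    by rewrite (unclaimed_Gam _ d (c w)).
  - by move=> M; exact: (sum_unclaimed_count _ _ _ _ _ D_iid _ _ _ _ r0 (ltW r1) hr _ mean_sq).
apply: (expect_far_lty _ (fun n w => unclaimed_count (fun i => D (- i)) d j n w) (2 * j).-1) => //.
- by move=> n; exact: (dmeas_unclaimed_count P F).
- move=> n w /(kth_left_far _ _ _ K0); apply: leq_ltn_trans.
  apply: leq_sum => k _; case: (boolP (_ && _)) => // /andP[h1 h2].
  rewrite (unclaimed_Gam _ d (c w))//.
  by rewrite -(claimedb_opp (Dd d (c w))).
- by move=> M; exact: (sum_unclaimed_count _ _ _ _ _ D'_iid _ _ _ _ r0 (ltW r1) hr _ mean_sq).
Qed.

Lemma expect_total_lty : (expect P (fun w => total_len d (c w) 0) < +oo)%E.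
Proof.
have m1 : dmeas (fun w => step1_len d (c w) 0) by exact: dmeas_step1_len.
have m2' : dmeas (fun w => step2_len d (c w) 0) by exact: dmeas_step2_len.
have m3 : dmeas (fun w => step3_len d (c w) 0) by exact: dmeas_step3_len.
rewrite /total_len expectD//; last exact: (dmeas_comp2 addn).
rewrite expectD//; apply: lte_add_pinfty; last exact: expect_step3_lty.
by apply: lte_add_pinfty; [exact: expect_step1_lty|exact: expect_step2_lty].
Qed.

End Model.
End Family.
End Finiteness.

(** * Choice of the truncation level *)

Lemma truncation_level (R : realType) (F : nat -> R) (F_ge0 : forall n, 0 <= F n)
  (F_mom2 : (\sum_(0 <= n <oo) ((n ^ 2)%:R * F n)%:E < +oo)%E) :
  exists m2 : R, exists d0 : nat, forall d, (d0 <= d)%N ->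
    (mean F (fun k => (32 * (k - d))%:R ^+ 2)%R <= m2%:E)%E /\
    (mean F (fun k => (32 * (k - d))%:R)%R <= (2^-1)%:E)%E.
Proof.
have sq0 k : 0 <= (k ^ 2)%:R :> R by [].
have hmean : (\sum_(0 <= n <oo) ((n ^ 2)%:R * F n)%:E = mean F (fun k => (k ^ 2)%:R))%E.
  by apply: eq_eseriesr => k _; rewrite mulrC.
have := mean_ge0 F F_ge0 _ sq0; move: F_mom2; rewrite hmean.
case hs : (mean F _) => [s| |]// _ _.
have fk0 k : (0 <= (F k * (32 * k)%:R)%:E)%E by rewrite lee_fin mulr_ge0.
have fin1 : (\sum_(0 <= k <oo) (F k * (32 * k)%:R)%:E < +oo)%E.
  apply: (@le_lt_trans _ _ (mean F (fun k => 32 * (k ^ 2)%:R))).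
    apply: le_mean => // k; rewrite -natrM ler_nat leq_mul2l /=.
    by case: k => // k; rewrite -mulnn leq_pmull.
  by rewrite meanZ// hs -EFinM ltry.
have cv := nneseries_tail_cvg fin1 (fun k _ => fk0 k).
(* The second moment of 32 D bounds that of the excess for every d. The mean excess is at most the
   tail from d of the convergent series of the mean degree, which determines d0. *)
exists (32 ^+ 2 * s).
have [d0 _ hd0] : \forall N \near \oo, (\sum_(N <= k <oo) (F k * (32 * k)%:R)%:E < (2^-1)%:E)%E.
  apply: (cv [set x | (x < (2^-1)%:E)%E]).
  by apply: open_nbhs_nbhs; split; [exact: open_ereal_lt_ereal|rewrite /= lte_fin invr_gt0].
exists d0 => d d0d; split.
  apply: (@le_trans _ _ (mean F (fun k => 32 ^+ 2 * (k ^ 2)%:R))).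
    apply: le_mean => // k; rewrite natrM exprMn ler_wpM2l ?exprn_ge0//.
    by rewrite -natrX ler_nat leq_exp2r// leq_subr.
  by rewrite meanZ ?exprn_ge0// hs EFinM.
apply: le_trans (ltW (hd0 d d0d)).
rewrite /mean (nneseries_split 0 d) => [|k _]; last by rewrite lee_fin mulr_ge0.
rewrite add0n big_nat big1 ?add0e => [|k /andP[_ kd]]; last first.
  by rewrite (_ : k - d = 0)%N ?muln0 ?mulr0//; lia.
apply: lee_nneseries => k _; first by rewrite lee_fin mulr_ge0.
by rewrite lee_fin ler_wpM2l// ler_nat leq_mul2l leq_subr.
Qed.

Theorem theorem4p1 (R : realType) (F : nat -> R)
  (F_ge0 : forall n, 0 <= F n)
  (F_sum1 : (\sum_(0 <= n <oo) (F n)%:E = 1)%E)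
  (F0 : F 0%N = 0)
  (F_mom2 : (\sum_(0 <= n <oo) ((n ^ 2)%:R * F n)%:E < +oo)%E) :
  exists d0 : nat, forall d : nat, ~~ odd d -> (d0 <= d)%N ->
  forall (dm : measure_display) (T : measurableType dm) (P : probability T R)
    (U : Src -> T -> R),
    (forall s, uniform01_rv P (U s)) ->
    mutually_independent P U ->
    {ae P, forall w, clusters_finite d (cfg_of F U w)} /\
    measurable_fun [set: T] (fun w => (total_len d (cfg_of F U w) 0)%:R : R) /\
    (\int[P]_w ((total_len d (cfg_of F U w) 0)%:R : R)%:E < +oo)%E.
Proof.
have [m2 [d0 hd0]] := truncation_level R F F_ge0 F_mom2.
exists d0 => d _ /hd0[hsq hsmall] dm T P U U_unif U_ind; split; [|split].
- exact: (clusters_finite_ae P F F_ge0 F_sum1 d m2).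
- apply: dmeas_measurable; apply: dmeas_total_len => s.
  by case: (U_unif s).
- exact: (expect_total_lty P F F_ge0 F_sum1 d m2).
Qed.
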